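(* Let $\mathcal{S}(\lambda)=\begin{bmatrix}A(\lambda)&B\\ C&D(\lambda)\end{bmatrix}$, where $A(\lambda)=\sum_{j=0}^m\lambda^jA_j\in\mathbb{C}[\lambda]^{n\times n}$ is regular of degree $m\ge1$, $D(\lambda)=\sum_{j=0}^k\lambda^jD_j\in\mathbb{C}[\lambda]^{r\times r}$ has degree $k\ge1$, $C\in\mathbb{C}^{r\times n}$ and $B\in\mathbb{C}^{n\times r}$. Let $h\in\{0,\dots,m-1\}$ and $\ell\in\{0,\dots,k-1\}$ be even. Let $w_h$ and $v_h+m$ be simple admissible tuples of $\{0,\dots,h\}$ and $\{0,\dots,m-h-1\}$, with symmetric complements $c_{w_h}$ and $c_{v_h}+m$, respectively; let $t_{w_h}$ and $t_{v_h}+m$ be index tuples in canonical form for $h$ and $m-h-1$, respectively; and let $X_A,Y_A$ be nonsingular matrix assignments for $t_{w_h},t_{v_h}$, respectively. Let $w_\ell$ and $v_\ell+k$ be simple admissible tuples of $\{0,\dots,\ell\}$ and $\{0,\dots,k-\ell-1\}$, with symmetric complements $c_{w_\ell}$ and $c_{v_\ell}+k$, respectively; let $t_{w_\ell}$ and $t_{v_\ell}+k$ be index tuples in canonical form for $\ell$ and $k-\ell-1$, respectively; and let $X_D,Y_D$ be nonsingular matrix assignments for $t_{w_\ell},t_{v_\ell}$, respectively. Put $$L_A(\lambda)=M_{(t_{v_h},t_{w_h})}(Y_A,X_A)\left(\lambda M^A_{v_h}-M^A_{w_h}\right)M^A_{(c_{w_h},c_{v_h})}M_{(\mathrm{rev}(t_{w_h}),\mathrm{rev}(t_{v_h}))}(\mathrm{rev}(X_A),\mathrm{rev}(Y_A)),$$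 $$L_D(\lambda)=N_{(t_{v_\ell},t_{w_\ell})}(Y_D,X_D)\left(\lambda N^D_{v_\ell}-N^D_{w_\ell}\right)N^D_{(c_{w_\ell},c_{v_\ell})}N_{(\mathrm{rev}(t_{w_\ell}),\mathrm{rev}(t_{v_\ell}))}(\mathrm{rev}(X_D),\mathrm{rev}(Y_D)),$$ $$\mathbb{L}(\lambda)=\left[\begin{array}{c|c} L_A(\lambda) & e_{m-i_0(t_{w_h},w_h)}e^T_{k-c_0(w_\ell,c_{w_\ell},\mathrm{rev}(t_{w_\ell}))}\otimes B\\ \hline e_{k-i_0(t_{w_\ell},w_\ell)}e^T_{m-c_0(w_h,c_{w_h},\mathrm{rev}(t_{w_h}))}\otimes C & L_D(\lambda)\end{array}\right].$$ Then $\mathbb{L}(\lambda)$ is a block symmetric GFPR of $\mathcal{S}(\lambda)$. Further, if $m$ and $k$ are both odd, then $\mathbb{L}(\lambda)$ is a Rosenbrock linearization of $\mathcal{S}(\lambda)$; and if $m$ (or $k$, or both) is (are) even, then $\mathbb{L}(\lambda)$ is a Rosenbrock linearization of $\mathcal{S}(\lambda)$ provided that the leading coefficient $A_m$ (or $D_k$, or both, respectively) is (are) nonsingular.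
   Context: Elementary matrices. For $P\in\mathbb{C}^{n\times n}$ define $mn\times mn$ matrices $M_0(P)=\mathrm{diag}(I_{(m-1)n},P)$, $M_{-m}(P)=\mathrm{diag}(P,I_{(m-1)n})$, and for $i=1,\dots,m-1$: $M_i(P)=\mathrm{diag}\left(I_{(m-i-1)n},\begin{bmatrix}P&I_n\\ I_n&0\end{bmatrix},I_{(i-1)n}\right)$, $M_{-i}(P)=\mathrm{diag}\left(I_{(m-i-1)n},\begin{bmatrix}0&I_n\\ I_n&P\end{bmatrix},I_{(i-1)n}\right)$. Set $M_i^A=M_i(-A_i)$ for $i=0,\dots,m-1$ and $M_i^A=M_i(A_{-i})$ for $i=-1,\dots,-m$. The $kr\times kr$ matrices $N_i(P)$, $P\in\mathbb{C}^{r\times r}$, $i\in\{-k,\dots,k-1\}$, and $N_i^D$ are defined in the same way with $(m,n,A)$ replaced by $(k,r,D)$. Index tuples and matrix assignments. An index tuple is a finite (possibly empty) ordered tuple of integers; $(s,t)$ denotes concatenation; $\mathrm{rev}$ reverses a tuple; $t+j$ adds $j$ to every entry; $(a:b)=(a,a+1,\dots,b)$, empty if $a>b$. For $p=(p_1,\dots,p_s)$ with entries in $\{-m,\dots,m-1\}$, a matrix assignment for $p$ is a tuple $P=(P_1,\dots,P_s)$ of $n\times n$ matrices, and $M_p(P)=M_{p_1}(P_1)\cdots M_{p_s}(P_s)$ (identity if $p$ is empty); $M_{(p,q)}(P,Q)=M_p(P)M_q(Q)$; $M^A_p=M^A_{p_1}\cdots M^A_{p_s}$ (the trivial assignment). The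 assignment $P$ is nonsingular if every $P_j$ with $p_j\in\{0,-m\}$ is nonsingular. Similarly for $N$, with $r\times r$ matrices, indices in $\{-k,\dots,k-1\}$, and special indices $0,-k$. A permutation of a finite set is viewed as a tuple listing each element exactly once. Column standard form. For a permutation $\gamma$ of $\{0,\dots,p\}$, $\mathrm{csf}(\gamma)$ is the unique tuple of the form $(m_q:n_q,\,m_{q-1}:n_{q-1},\dots,m_1:n_1)$ with $0\le n_1<\dots<n_q\le p$ and $0\le m_i\le n_i$ that can be obtained from $\gamma$ by repeatedly interchanging adjacent entries $i,j$ with $|i-j|>1$. Admissible tuples. Let $p\ge0$. An admissible tuple of $\{0,\dots,p\}$ is a permutation $\gamma$ of $\{0,\dots,p\}$ with $\mathrm{csf}(\gamma)=(p-1:p,\,p-3:p-2,\dots,q+1:q+2,\,0:q)$ for some $0\le q\le p$; $q=\mathrm{Ind}(\gamma)$ is its index. It is simple if $q\in\{0,1\}$. Its symmetric complement is $c_\gamma=(p-1,p-3,\dots,q+3,q+1,(0:q)_{\mathrm{rev}_c})$ if $q\ge1$, where $(0:q)_{\mathrm{rev}_c}=(0:q-1,0:q-2,\dots,0:1,0)$; $c_\gamma=(p-1,p-3,\dots,1)$ if $q=0$ and $p>0$; and $c_\gamma=\emptyset$ if $p=0$. Canonical form. An index tuple is in canonical form for $p\ge 0$ if it equals $(s_1:p-2,\,s_2:p-4,\dots,s_{\lfloor p/2\rfloor}:p-2\lfloor p/2\rfloor)$ with all $s_j\ge0$ (it is empty if $p\in\{0,1\}$). SIP. A tuple $(j_1,\dots,j_p)$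 of nonnegative integers satisfies the SIP if whenever $j_s=j_t$ with $s<t$ there is $s<q<t$ with $j_q=j_s+1$. A tuple with entries in $\{-h,\dots,-1\}$ satisfies the SIP if the tuple obtained by adding $h$ does. Consecutions and inversions. A subtuple is obtained by deleting some (possibly no) entries, keeping the order. For a tuple $\gamma$ of nonnegative integers containing $0$, $c_0(\gamma)$ is the largest $s$ such that $(0,1,\dots,s)$ is a subtuple of $\gamma$, and $i_0(\gamma)$ is the largest $s$ such that $(s,\dots,1,0)$ is a subtuple of $\gamma$. GFPR. A GFPR of $\mathcal{S}(\lambda)=\begin{bmatrix}A&B\\ C&D\end{bmatrix}$ is a pencil $$\left[\begin{array}{c|c} L_A(\lambda) & e_{m-i_0(\sigma_1,\sigma)}e^T_{k-c_0(\gamma,\gamma_2)}\otimes B\\ \hline e_{k-i_0(\gamma_1,\gamma)}e^T_{m-c_0(\sigma,\sigma_2)}\otimes C & L_D(\lambda)\end{array}\right]$$ with $L_A=M_{(\tau_1,\sigma_1)}(Y_1^A,X_1^A)(\lambda M^A_\tau-M^A_\sigma)M_{(\sigma_2,\tau_2)}(X_2^A,Y_2^A)$ and $L_D=N_{(\delta_1,\gamma_1)}(Y_1^D,X_1^D)(\lambda N^D_\delta-N^D_\gamma)N_{(\gamma_2,\delta_2)}(X_2^D,Y_2^D)$, where for some $h\in\{0,\dots,m-1\}$: $\sigma,\tau$ are permutations of $\{0,\dots,h\}$ and $\{-m,\dots,-h-1\}$, $\sigma_1,\sigma_2$ have entries in $\{0,\dots,h-1\}$, $\tau_1,\tau_2$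 have entries in $\{-m,\dots,-h-2\}$, $(\sigma_1,\sigma,\sigma_2)$ and $(\tau_1,\tau,\tau_2)$ satisfy the SIP, and $X_1^A,X_2^A,Y_1^A,Y_2^A$ are matrix assignments for $\sigma_1,\sigma_2,\tau_1,\tau_2$; and the analogous conditions hold for $\gamma,\delta,\gamma_1,\gamma_2,\delta_1,\delta_2$ with $(m,h)$ replaced by $(k,\ell)$ for some $\ell\in\{0,\dots,k-1\}$. Block symmetry. The block transpose of a block matrix $\mathcal{M}=[M_{ij}]$ is $\mathcal{M}^{\mathcal{B}}=[M_{ji}]$ (the blocks themselves are not transposed). For $\mathbb{S}=\left[\begin{array}{c|c}\mathcal{A}&uv^T\otimes B\\ \hline sz^T\otimes C&\mathcal{D}\end{array}\right]$ with $u,z\in\mathbb{C}^m$, $v,s\in\mathbb{C}^k$, $\mathcal{A}$ an $m\times m$ block matrix with $n\times n$ blocks and $\mathcal{D}$ a $k\times k$ block matrix with $r\times r$ blocks, the Rosenbrock block transpose is $\mathbb{S}^{\mathbb{B}}=\left[\begin{array}{c|c}\mathcal{A}^{\mathcal{B}}&zs^T\otimes B\\ \hline vu^T\otimes C&\mathcal{D}^{\mathcal{B}}\end{array}\right]$; $\mathbb{S}$ is block symmetric if $\mathcal{A}^{\mathcal B}=\mathcal{A}$, $\mathcal{D}^{\mathcal B}=\mathcal{D}$, $u=z$ and $v=s$. $e_j$ denotes the $j$-th standard basis (column) vector, of $\mathbb{C}^m$ when written $e_{m-\cdot}$ and of $\mathbb{C}^k$ when written $e_{k-\cdot}$; $\otimes$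 is the Kronecker product. Rosenbrock linearization. A pencil $\mathbb{L}(\lambda)$ of size $mn+kr$ is a Rosenbrock linearization of $\mathcal{S}(\lambda)$ if there are unimodular matrix polynomials $U_A,V_A$ of size $mn$ and $U_D,V_D$ of size $kr$ with $\mathrm{diag}(U_A,U_D)\,\mathbb{L}\,\mathrm{diag}(V_A,V_D)=\mathrm{diag}(I_{(m-1)n},\mathcal{S},I_{(k-1)r})$. *)

(* Defs.v *)
From HB Require Import structures.
From mathcomp Require Import all_boot all_order all_algebra.
From mathcomp Require Import mxtens complex reals.

Set Implicit Arguments.
Unset Strict Implicit.
Unset Printing Implicit Defensive.

Import Order.TTheory GRing.Theory Num.Theory.
Local Open Scope ring_scope.

(* (a : b) = (a, a + 1, ..., b), empty when a > b *)
Definition irange (a b : int) : seq int :=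
  if a <= b then [seq a + i%:Z | i <- iota 0 `|b - a|%N.+1] else [::].

Definition tshift (j : int) (t : seq int) : seq int := [seq i + j | i <- t].

(* tuple_equiv s t: t is obtained from s by repeatedly interchanging adjacent
   entries a, b with |a - b| > 1 *)
Inductive tuple_equiv (s : seq int) : seq int -> Prop :=
| tuple_equiv_refl : tuple_equiv s s
| tuple_equiv_swap (t u : seq int) (a b : int) :
    1 < `|a - b| -> tuple_equiv s (t ++ [:: a, b & u]) ->
    tuple_equiv s (t ++ [:: b, a & u]).

(* the list x holds the pairs (m_q, n_q), ..., (m_1, n_1) *)
Definition in_csf (p : nat) (t : seq int) : Prop :=
  exists x : seq (nat * nat),
    [/\ sorted (fun y z => (z.2 < y.2)%N) x,
        all (fun y => (y.1 <= y.2 <= p)%N) x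
      & t = flatten [seq irange (y.1)%:Z (y.2)%:Z | y <- x]].

Definition is_csf (p : nat) (g t : seq int) : Prop :=
  in_csf p t /\ tuple_equiv g t.

(* (p-1 : p, p-3 : p-2, ..., q+1 : q+2, 0 : q), for q <= p of the same parity *)
Definition admissible_csf (p q : nat) : seq int :=
  flatten [seq irange (p%:Z - (2 * j)%:Z - 1) (p%:Z - (2 * j)%:Z)
          | j <- iota 0 (p - q)./2]
  ++ irange 0 q.

Definition admissible_of_index (p q : nat) (g : seq int) : Prop :=
  [/\ perm_eq g (irange 0 p), (q <= p)%N, ~~ odd (p - q)
    & is_csf p g (admissible_csf p q)].

Definition simple_admissible (p : nat) (g : seq int) : Prop :=
  exists2 q : nat, (q == 0%N) || (q == 1%N) & admissible_of_index p q g.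

(* (0 : q)_{rev_c} = (0 : q-1, 0 : q-2, ..., 0 : 1, 0), empty for q = 0 *)
Definition revc (q : nat) : seq int :=
  flatten [seq irange 0 (q%:Z - 1 - j%:Z) | j <- iota 0 q].

(* (p-1, p-3, ..., q+1, (0 : q)_{rev_c}); for q = 0 this is (p-1, ..., 3, 1),
   and it is empty for p = q = 0 *)
Definition symcompl_of_index (p q : nat) : seq int :=
  [seq p%:Z - (2 * j)%:Z - 1 | j <- iota 0 (p - q)./2] ++ revc q.

Definition symmetric_complement (p : nat) (g c : seq int) : Prop :=
  exists2 q : nat, admissible_of_index p q g & c = symcompl_of_index p q.

Definition in_canonical_form (p : nat) (t : seq int) : Prop :=
  exists s : nat -> nat,
    t = flatten [seq irange (s j) (p%:Z - (2 * j)%:Z) | j <- iota 1 p./2].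

Definition SIP (t : seq int) : Prop :=
  forall a b : nat, (a < b < size t)%N -> nth 0 t a = nth 0 t b ->
  exists2 c : nat, (a < c < b)%N & nth 0 t c = nth 0 t a + 1.

(* Meaningful on tuples that contain 0. *)
Definition c0 (g : seq int) : nat :=
  \max_(s < size g | subseq (irange 0 s) g) s.
Definition i0 (g : seq int) : nat :=
  \max_(s < size g | subseq (rev (irange 0 s)) g) s.

Definition blk (T : Type) (m n : nat) (M : 'M[T]_(m * n)) (a b : 'I_m) :
    'M[T]_n :=
  \matrix_(i, j) M (mxtens_index (a, i)) (mxtens_index (b, j)).

Definition of_blk (T : Type) (m n : nat) (F : 'I_m -> 'I_m -> 'M[T]_n) :
    'M[T]_(m * n) :=
  \matrix_(i, j) F (mxtens_unindex i).1 (mxtens_unindex j).1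
                   (mxtens_unindex i).2 (mxtens_unindex j).2.

Definition blktr (T : Type) (m n : nat) (M : 'M[T]_(m * n)) : 'M[T]_(m * n) :=
  of_blk (fun a b => blk M b a).

(* diag (I_{p n}, P, I_{(m - p - 1) n}) *)
Definition blkdiag1 (F : nzRingType) (m n p : nat) (P : 'M[F]_n) :
    'M[F]_(m * n) :=
  of_blk (fun a b : 'I_m =>
    if (a == p :> nat) && (b == p :> nat) then P else ((a == b)%:R)%:M).

(* diag (I_{p n}, [P Q; S T], I_{(m - p - 2) n}) *)
Definition blkdiag2 (F : nzRingType) (m n p : nat) (P Q S T : 'M[F]_n) :
    'M[F]_(m * n) :=
  of_blk (fun a b : 'I_m =>
    if      (a == p :> nat)   && (b == p :> nat)   then P
    else if (a == p :> nat)   && (b == p.+1 :> nat) then Q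
    else if (a == p.+1 :> nat) && (b == p :> nat)   then S
    else if (a == p.+1 :> nat) && (b == p.+1 :> nat) then T
    else ((a == b)%:R)%:M).

(* M_i(P), for -m <= i <= m - 1; the matrices N_i(P) are the same with (k, r)
   for (m, n). *)
Definition elem_mx (F : nzRingType) (m n : nat) (i : int) (P : 'M[F]_n) :
    'M[F]_(m * n) :=
  if i == 0 then blkdiag1 m m.-1 P
  else if i == - m%:Z then blkdiag1 m 0 P
  else if 0 < i then blkdiag2 m (m - `|i| - 1) P 1%:M 1%:M 0
  else blkdiag2 m (m - `|i| - 1) 0 1%:M 1%:M P.

Definition assignment (T : Type) (n : nat) (t : seq int) (P : seq 'M[T]_n) :
    Prop :=
  size P = size t.

Definition nonsingular_assignment (F : fieldType) (m n : nat) (t : seq int)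
    (P : seq 'M[F]_n) : Prop :=
  assignment t P /\
  forall j : nat, (j < size t)%N ->
    (nth 0 t j == 0) || (nth 0 t j == - m%:Z) -> nth 0 P j \in unitmx.

Definition elem_prod (F : nzRingType) (m n : nat) (t : seq int)
    (P : seq 'M[F]_n) : 'M[F]_(m * n) :=
  \big[mulmx/1%:M]_(x <- zip t P) elem_mx m x.1 x.2.

Definition trivial_assignment (F : nzRingType) (n : nat) (A : nat -> 'M[F]_n)
    (t : seq int) : seq 'M[F]_n :=
  [seq if 0 <= i then - A `|i|%N else A `|i|%N | i <- t].

Definition elem_prodA (F : nzRingType) (m n : nat) (A : nat -> 'M[F]_n)
    (t : seq int) : 'M[F]_(m * n) :=
  elem_prod m t (trivial_assignment A t).

Notation mxC M := (map_mx polyC M).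

Definition mx_poly (F : fieldType) (n m : nat) (A : nat -> 'M[F]_n) :
    'M[{poly F}]_n :=
  \sum_(j < m.+1) 'X^j *: mxC (A j).

Definition regular_mxpoly (F : fieldType) (n : nat) (P : 'M[{poly F}]_n) :
    Prop :=
  \det P != 0.

Definition pencil (F : fieldType) (N : nat) (M1 M0 : 'M[F]_N) :
    'M[{poly F}]_N :=
  'X *: mxC M1 - mxC M0.

(* e_j in F^m, with j counted from 1 *)
Definition evec (F : nzRingType) (m j : nat) : 'cV[F]_m :=
  \col_(a < m) (a.+1 == j)%:R.

(* A polynomial matrix [ RA, u v^T (x) B ; s z^T (x) C, RD ] together with the
   vectors u, v, s, z; block symmetry refers to this presentation, which the
   matrix alone does not determine (for instance when B = 0). *)
Record rosen_form (F : fieldType) (m n k r : nat) := RosenForm {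
  rfA : 'M[{poly F}]_(m * n);
  rfu : 'cV[F]_m;
  rfv : 'cV[F]_k;
  rfB : 'M[F]_(n, r);
  rfs : 'cV[F]_k;
  rfz : 'cV[F]_m;
  rfC : 'M[F]_(r, n);
  rfD : 'M[{poly F}]_(k * r)
}.

Definition rosen_mx (F : fieldType) (m n k r : nat)
    (S : rosen_form F m n k r) : 'M[{poly F}]_(m * n + k * r) :=
  block_mx (rfA S) (mxC ((rfu S *m (rfv S)^T) *t rfB S))
           (mxC ((rfs S *m (rfz S)^T) *t rfC S)) (rfD S).

Definition block_symmetric (F : fieldType) (m n k r : nat)
    (S : rosen_form F m n k r) : Prop :=
  [/\ blktr (rfA S) = rfA S, blktr (rfD S) = rfD S,
      rfu S = rfz S & rfv S = rfs S].

(* The conditions on one diagonal block L of a GFPR, with (m, n, A) or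
   (k, r, D): it comes from tuples and assignments as in the definition of a
   GFPR, with i = i_0(s1, s) and c = c_0(s, s2). *)
Definition GFPR_block (F : fieldType) (m n : nat) (A : nat -> 'M[F]_n)
    (L : 'M[{poly F}]_(m * n)) (i c : nat) : Prop :=
  exists (h : nat) (s t s1 s2 t1 t2 : seq int) (X1 X2 Y1 Y2 : seq 'M[F]_n),
    [/\ (h < m)%N,
        perm_eq s (irange 0 h) & perm_eq t (irange (- m%:Z) (- h%:Z - 1))] /\
    [/\ all (fun j => 0 <= j <= h%:Z - 1) s1,
        all (fun j => 0 <= j <= h%:Z - 1) s2,
        all (fun j => - m%:Z <= j <= - h%:Z - 2) t1
      & all (fun j => - m%:Z <= j <= - h%:Z - 2) t2] /\
    [/\ SIP (s1 ++ s ++ s2) & SIP (tshift m (t1 ++ t ++ t2))] /\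
    [/\ assignment s1 X1, assignment s2 X2, assignment t1 Y1
      & assignment t2 Y2] /\
    [/\ L = mxC (elem_prod m (t1 ++ s1) (Y1 ++ X1))
              *m pencil (elem_prodA m A t) (elem_prodA m A s)
              *m mxC (elem_prod m (s2 ++ t2) (X2 ++ Y2)),
        i = i0 (s1 ++ s) & c = c0 (s ++ s2)].

Definition is_GFPR (F : fieldType) (m n k r : nat) (A : nat -> 'M[F]_n)
    (B : 'M[F]_(n, r)) (C : 'M[F]_(r, n)) (D : nat -> 'M[F]_r)
    (S : rosen_form F m n k r) : Prop :=
  exists (LA : 'M[{poly F}]_(m * n)) (LD : 'M[{poly F}]_(k * r))
         (iA cA iD cD : nat),
    [/\ GFPR_block A LA iA cA, GFPR_block D LD iD cD
      & S = RosenForm LA (evec F m (m - iA)) (evec F k (k - cD)) B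
                      (evec F k (k - iD)) (evec F m (m - cA)) C LD].

(* diag (I_{(m-1) n}, S, I_{(k-1) r}) for S = [ A, B ; C, D ], partitioned after
   the first m n rows and columns: the block A is the last one of the upper
   left part and D the first one of the lower right part. *)
Definition rosen_target (F : fieldType) (m n k r : nat)
    (A : 'M[{poly F}]_n) (B : 'M[F]_(n, r)) (C : 'M[F]_(r, n))
    (D : 'M[{poly F}]_r) : 'M[{poly F}]_(m * n + k * r) :=
  rosen_mx (RosenForm (blkdiag1 m m.-1 A) (evec F m m) (evec F k 1) B
                      (evec F k 1) (evec F m m) C (blkdiag1 k 0 D)).

(* A square polynomial matrix is unimodular iff it is in [unitmx]. *)
Definition rosenbrock_linearization (F : fieldType) (m n k r : nat)
    (A : 'M[{poly F}]_n) (B : 'M[F]_(n, r)) (C : 'M[F]_(r, n))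
    (D : 'M[{poly F}]_r) (L : 'M[{poly F}]_(m * n + k * r)) : Prop :=
  exists (UA VA : 'M[{poly F}]_(m * n)) (UD VD : 'M[{poly F}]_(k * r)),
    [/\ UA \in unitmx, VA \in unitmx, UD \in unitmx & VD \in unitmx] /\
    block_mx UA 0 0 UD *m L *m block_mx VA 0 0 VD = rosen_target m k A B C D.

Definition symmetric_pencil (F : fieldType) (m n : nat) (A : nat -> 'M[F]_n)
    (w v cw cv tw tv : seq int) (X Y : seq 'M[F]_n) : 'M[{poly F}]_(m * n) :=
  mxC (elem_prod m (tv ++ tw) (Y ++ X))
    *m pencil (elem_prodA m A v) (elem_prodA m A w)
    *m mxC (elem_prodA m A (cw ++ cv))
    *m mxC (elem_prod m (rev tw ++ rev tv) (rev X ++ rev Y)).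

(* Main.v *)
Require Import Defs.
From HB Require Import structures.
From mathcomp Require Import all_boot all_order all_algebra.
From mathcomp Require Import mxtens complex reals.
From mathcomp Require Import zify ring.

(** The two diagonal blocks are treated separately by the same statement
    ([diagonal_block]) and then glued ([rosenbrock_glue]).  Blocks are counted
    from the bottom: [f_i] stands for the block column unit [bcol _ m n i].
    In this numbering every elementary matrix has the same shape [emx a b P]
    on two blocks [a], [b]: it sends [f_a] to [f_a P + f_b] and [f_b] to [f_a].
    The matrix of index [i >= 0] has [(a, b) = (i, i - 1)], the one of index
    [-i < 0] has [(a, b) = (i - 1, i)], and a block number that is out of range
    stands for nothing.

    Since elementary matrices commute when their indices are not adjacent, a
    simple admissible tuple [w] of [{0, ..., h}], [h] even, may be replaced by
    the odd indices below [h] followed by the even ones; its symmetric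
    complement consists of these odd indices.  On the negative side the
    even [|i|] come first and form the complement.  Hence, with
    [P], [Q] the products over odd and even indices on the nonnegative side,
    and [E], [O] those over even and odd [|i|] on the negative side, the pencil is
    [(X E O - P Q) P E] between the products attached to [tv], [tw] and to their
    reverses.

    Block symmetry.  Both coefficients of the pencil split into a factor acting
    on the blocks [>= b] and one acting on the blocks [< b]
    ([block_sym_prod_vw]), and each factor arises from a block symmetric matrix
    by steps [S -> M S M] with [M] elementary.  Such a step keeps block symmetry
    provided that the block row of [S] which gets multiplied consists of scalar
    blocks and vanishes in the two columns that [M] touches
    ([block_sym_step]); otherwise noncommuting products of blocks would occur.
    The canonical form guarantees that the relevant rows are still of this kind
    when their turn comes ([nest_canonical]).

    Linearization.  We have [X E O - P Q = P E (X P^-1 O - E^-1 Q)], and the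
    pencil in parentheses no longer depends on [h]: it is block tridiagonal
    ([tri_pencil_tridiagonal]).  For such a pencil [T] there are explicit
    polynomial solutions of [T z = f_0 A(X)] and [y T = A(X) f_0^T] whose block
    at [0] is the identity ([tridiagonal_solution]), and bordering with them
    leaves [diag (I, A(X))] up to a unimodular factor
    ([tridiagonal_linearization]).  The matrix [E] contains the index [-m]
    exactly when [m] is even, and this is where the nonsingularity of [A_m]
    enters.

    The corner blocks.  The constant factors left and right of [T] map [f_0] to
    [f_s], where [s] is the number of inversions at [0] of [(tw, w)], which is
    also the number of consecutions at [0] of [(w, cw, rev tw)]
    ([left_factor_bcol], [brow_right_factor]): the SIP ensures that an
    index [i] is never applied to [f_i], so that [f_s] moves to [f_(s + 1)] at
    the index [s + 1] and is fixed by all other indices ([emx_prod_w_i0]).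

    The SIP itself only concerns, for each [i], the subtuple of the entries [i]
    and [i + 1]; these subtuples do not change when nonadjacent entries are
    interchanged, so they can be read off from the sorted form of [w]
    ([adj_SIP_palindrome]). *)

Set Implicit Arguments.
Unset Strict Implicit.
Unset Printing Implicit Defensive.

Import Order.TTheory GRing.Theory Num.Theory.
Local Open Scope ring_scope.

(** * Block columns and elementary matrices *)

(** Block [j] is counted from the bottom, so that an elementary matrix of index
    [i > 0] acts on the blocks [i] and [i - 1].  For [m <= j] this is zero, which
    spares the special cases at both ends of the index range. *)
Definition bcol (R : nzRingType) (m n j : nat) : 'M[R]_(m * n, n) :=
  \matrix_(x, y) (((((mxtens_unindex x).1 + j).+1 == m)%N)
                  && ((mxtens_unindex x).2 == y))%:R.

Definition brow (R : nzRingType) (m n j : nat) : 'M[R]_(n, m * n) :=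
  (bcol R m n j)^T.

(** With [b] out of range this is the diagonal matrix with the single block [P]
    at [a], as for the indices [0] and [-m]. *)
Definition emx (R : nzRingType) (m n a b : nat) (P : 'M[R]_n) : 'M[R]_(m * n) :=
  1%:M + bcol R m n a *m (P - 1%:M) *m brow R m n a
  + bcol R m n a *m brow R m n b + bcol R m n b *m brow R m n a
  - bcol R m n b *m brow R m n b.

Section BlockUnits.

Variables (R : comUnitRingType) (m n : nat).
Local Notation fc := (bcol R m n).
Local Notation fr := (brow R m n).
Local Notation em := (@emx R m n).

Lemma bcol_out j : (m <= j)%N -> fc j = 0.
Proof.
move=> le_mj; apply/matrixP=> x y; rewrite !mxE.
by case: eqP => // E; case: (mxtens_unindex x).1 E => a /= ? ?; lia.
Qed.

Lemma brow_out j : (m <= j)%N -> fr j = 0.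
Proof. by move=> le_mj; rewrite /brow bcol_out // trmx0. Qed.

Lemma mulmx_bcolE p (M : 'M[R]_(p, m * n)) (a : 'I_m) x y :
  (M *m fc (m - a.+1)) x y = M x (mxtens_index (a, y)).
Proof.
rewrite !mxE (bigD1 (mxtens_index (a, y))) //= big1 ?addr0.
  rewrite !mxE mxtens_indexK /= eqxx andbT.
  by have -> : ((a + (m - a.+1)).+1 == m)%N; [case: a => a /= ?; lia | rewrite mulr1].
move=> z; case: (mxtens_indexP z) => b y'; rewrite !mxE mxtens_indexK /= => ne.
case: eqP => [E|_] /=; last by rewrite mulr0.
case: eqP => [E'|_] /=; last by rewrite mulr0.
case/eqP: ne; rewrite E'; congr (mxtens_index (_, _)); apply: val_inj => /=.
by case: a b E => a /= ? [b /= ?]; lia.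
Qed.

Lemma brow_mulmxE p (M : 'M[R]_(m * n, p)) (a : 'I_m) x y :
  (fr (m - a.+1) *m M) x y = M (mxtens_index (a, x)) y.
Proof.
have -> : fr (m - a.+1) *m M = (M^T *m fc (m - a.+1))^T.
  by rewrite trmx_mul trmxK.
by rewrite mxE mulmx_bcolE mxE.
Qed.

Lemma brow_bcol a b : fr a *m fc b = if (a == b) && (a < m)%N then 1%:M else 0.
Proof.
have [lt_am|le_ma] := ltnP a m; last by rewrite brow_out // mul0mx andbF.
have lt_a' : (m - a.+1 < m)%N by lia.
apply/matrixP=> x y; rewrite andbT.
have Ea : a = (m - (Ordinal lt_a').+1)%N by move=> /=; lia.
rewrite {1}Ea brow_mulmxE mxE mxtens_indexK /=.
have -> : ((m - a.+1 + b).+1 == m)%N = (a == b) by apply/eqP/eqP; lia.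
by case: ifP; rewrite !mxE.
Qed.

Lemma brow_bcol_id a : (a < m)%N -> fr a *m fc a = 1%:M.
Proof. by rewrite brow_bcol eqxx => ->. Qed.

Lemma brow_bcol0 a b : a != b -> fr a *m fc b = 0.
Proof. by rewrite brow_bcol => /negPf->. Qed.

Lemma blkE (M : 'M[R]_(m * n)) (a b : 'I_m) :
  blk M a b = fr (m - a.+1) *m M *m fc (m - b.+1).
Proof. by apply/matrixP=> i j; rewrite mulmx_bcolE brow_mulmxE mxE. Qed.

Lemma blk_ext (M N : 'M[R]_(m * n)) :
  (forall a b, (a < m)%N -> (b < m)%N ->
     fr a *m M *m fc b = fr a *m N *m fc b) -> M = N.
Proof.
move=> eqMN; apply/matrixP=> x y.
case: (mxtens_indexP x) => a i; case: (mxtens_indexP y) => b j.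
have := eqMN _ _ (ltn_ord (rev_ord a)) (ltn_ord (rev_ord b)) => /=.
by move/matrixP/(_ i j); rewrite !mulmx_bcolE !brow_mulmxE.
Qed.

Lemma sum_bcol_brow : \sum_(j < m) fc j *m fr j = 1%:M.
Proof.
apply: blk_ext => a b lt_am lt_bm.
rewrite mulmx1 brow_bcol lt_am andbT mulmx_sumr mulmx_suml (bigD1 (Ordinal lt_am)) //=.
rewrite big1 ?addr0 => [|j ne].
  by rewrite mulmxA brow_bcol eqxx lt_am /= mul1mx brow_bcol lt_am andbT.
rewrite mulmxA brow_bcol; case: eqP => [E|] /=; last by rewrite !mul0mx.
by case/eqP: ne; apply: val_inj.
Qed.

Lemma brow_of_blk_bcol (F : 'I_m -> 'I_m -> 'M[R]_n) (a b : 'I_m) :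
  fr (m - a.+1) *m of_blk F *m fc (m - b.+1) = F a b.
Proof.
by apply/matrixP=> i j; rewrite mulmx_bcolE brow_mulmxE mxE !mxtens_indexK.
Qed.

Lemma tr_bcol j : (fc j)^T = fr j. Proof. by []. Qed.
Lemma tr_brow j : (fr j)^T = fc j. Proof. by rewrite trmxK. Qed.

Lemma emx_bcol_fst a b P : (a < m)%N -> a != b -> em a b P *m fc a = fc a *m P + fc b.
Proof.
move=> lt_am ne; have ne' : b != a by rewrite eq_sym.
rewrite /emx !(mulmxDl, mulNmx) -!mulmxA brow_bcol_id // brow_bcol0 // !mulmx0 !mulmx1 mul1mx.
by rewrite mulmxBr mulmx1 subr0 addr0 addrCA subrr addr0.
Qed.

Lemma emx_bcol_snd a b P : (b < m)%N -> a != b -> em a b P *m fc b = fc a.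
Proof.
move=> lt_bm ne.
rewrite /emx !(mulmxDl, mulNmx) -!mulmxA brow_bcol_id // brow_bcol0 // !mulmx0 !mulmx1 mul1mx.
by rewrite !addr0 addrAC subrr add0r.
Qed.

Lemma emx_bcol_id a b P c : a != c -> b != c -> em a b P *m fc c = fc c.
Proof.
move=> ne1 ne2.
rewrite /emx !(mulmxDl, mulNmx) -!mulmxA !brow_bcol0 // !mulmx0 mul1mx.
by rewrite subr0 !addr0.
Qed.

Let trD p q (X Y : 'M[R]_(p, q)) : (X + Y)^T = X^T + Y^T.
Proof. exact: linearD. Qed.
Let trN p q (X : 'M[R]_(p, q)) : (- X)^T = - X^T.
Proof. exact: linearN. Qed.

Lemma tr_emx a b P : (em a b P)^T = em a b P^T.
Proof.
rewrite /emx !trD trN !trmx1 !trmx_mul !tr_bcol !tr_brow trD trN trmx1.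
by rewrite mulmxA; congr (_ - _); rewrite -!addrA; congr (_ + (_ + _)); rewrite addrC.
Qed.

Lemma brow_emx_fst a b P : (a < m)%N -> a != b -> fr a *m em a b P = P *m fr a + fr b.
Proof.
move=> lt_am ne; apply: trmx_inj.
by rewrite trD !trmx_mul tr_emx !tr_brow emx_bcol_fst.
Qed.

Lemma brow_emx_snd a b P : (b < m)%N -> a != b -> fr b *m em a b P = fr a.
Proof. by move=> lt ne; apply: trmx_inj; rewrite !trmx_mul tr_emx !tr_brow emx_bcol_snd. Qed.

Lemma brow_emx_id a b P c : a != c -> b != c -> fr c *m em a b P = fr c.
Proof. by move=> ? ?; apply: trmx_inj; rewrite !trmx_mul tr_emx !tr_brow emx_bcol_id. Qed.

Lemma bcol_ext (M N : 'M[R]_(m * n)) :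
  (forall a, (a < m)%N -> M *m fc a = N *m fc a) -> M = N.
Proof. by move=> E; apply: blk_ext => a b _ lt; rewrite -!mulmxA E. Qed.

(** Both differences from the identity are supported on the touched blocks, so
    their products vanish; two out-of-range second blocks may coincide. *)
Lemma emx_comm a b c d P Q : a != c -> a != d -> b != c ->
  (b != d) || (m <= b)%N ->
  em a b P *m em c d Q = em c d Q *m em a b P.
Proof.
move=> ac ad bc bd.
have sw x y : x != y -> y != x by rewrite eq_sym.
pose X := em a b P - 1; pose Y := em c d Q - 1.
have EX : em a b P = 1%:M + X by rewrite addrC subrK.
have EY : em c d Q = 1%:M + Y by rewrite addrC subrK.
have HX : X = fc a *m ((P - 1%:M) *m fr a + fr b) + fc b *m (fr a - fr b).
  rewrite /X /emx [fc a *m (_ *m _ + _)]mulmxDr [fc b *m (_ - _)]mulmxBr !mulmxA.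
  by rewrite [LHS]addrC !addrA addNr add0r.
have HY : Y = fc c *m ((Q - 1%:M) *m fr c + fr d) + fc d *m (fr c - fr d).
  rewrite /Y /emx [fc c *m (_ *m _ + _)]mulmxDr [fc d *m (_ - _)]mulmxBr !mulmxA.
  by rewrite [LHS]addrC !addrA addNr add0r.
have X0 e : a != e -> (b != e) || (m <= e)%N -> X *m fc e = 0.
  move=> ne; have [le _|lt] := leqP m e; first by rewrite bcol_out ?mulmx0.
  by rewrite orbF => ?; rewrite mulmxBl emx_bcol_id // mul1mx subrr.
have Y0 e : c != e -> (d != e) || (m <= e)%N -> Y *m fc e = 0.
  move=> ne; have [le _|lt] := leqP m e; first by rewrite bcol_out ?mulmx0.
  by rewrite orbF => ?; rewrite mulmxBl emx_bcol_id // mul1mx subrr.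
have bd' : (b != d) || (m <= d)%N by case/orP: bd => [->//|]; case: eqVneq => // ->.
have XY0 : X *m Y = 0.
  by rewrite HY mulmxDr !mulmxA !X0 ?bc // !mul0mx addr0.
have YX0 : Y *m X = 0.
  by rewrite HX mulmxDr !mulmxA !Y0 ?(eq_sym d) ?ad ?mul0mx ?addr0 // sw.
clear HX HY; clearbody X Y.
rewrite EX EY !mulmxDl !mulmxDr !mul1mx !mulmx1 XY0 YX0 !addr0.
by rewrite -!addrA [X + Y]addrC.
Qed.

Lemma emx_inv a b P : (a < m)%N -> (b < m)%N -> a != b ->
  em a b P *m em b a (- P) = 1%:M.
Proof.
move=> lt_a lt_b ne; have ne' : b != a by rewrite eq_sym.
apply: bcol_ext => c lt_c; rewrite mul1mx -mulmxA.
have [->|nca] := eqVneq c a.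
  by rewrite emx_bcol_snd // emx_bcol_snd.
have [->|ncb] := eqVneq c b; last by rewrite !emx_bcol_id // eq_sym.
rewrite emx_bcol_fst // mulmxDr mulmxA emx_bcol_snd // emx_bcol_fst //.
by rewrite mulmxN addKr.
Qed.

Lemma emx_unit a b P : (a < m)%N -> (b < m)%N -> a != b -> em a b P \in unitmx.
Proof. by move=> lt_a lt_b ne; case: (mulmx1_unit (emx_inv P lt_a lt_b ne)). Qed.

Lemma emx_out_inv a P Q : (a < m)%N -> P *m Q = 1%:M ->
  em a m P *m em a m Q = 1%:M.
Proof.
move=> lt_a PQ; apply: bcol_ext => c lt_c; rewrite mul1mx -mulmxA.
have ne : a != m by rewrite ltn_eqF.
have nm : m != c by rewrite gtn_eqF.
have c0 : fc m = 0 by rewrite bcol_out.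
have [->|nca] := eqVneq c a; last by rewrite !emx_bcol_id // eq_sym.
by rewrite emx_bcol_fst // c0 addr0 mulmxA emx_bcol_fst // c0 addr0 -mulmxA PQ mulmx1.
Qed.

Lemma emx_out_unit a P : (a < m)%N -> P \in unitmx -> em a m P \in unitmx.
Proof.
by move=> lt_a uP; exact: (mulmx1_unit (emx_out_inv lt_a (mulmxV uP))).1.
Qed.

(** Index [i >= 0] acts on the blocks [place_w i.+1 = i] and [place_w i], the
    latter being out of range for [i = 0]. *)
Definition place_w i := if i is i'.+1 then i' else m.
(** Index [j - m < 0] acts on the blocks [place_v j.+1] and [place_v j]; for
    [j = 0], which is the index [-m], the second one is out of range. *)
Definition place_v i := (m - i)%N.

Lemma block_from_bottom a : (a < m)%N -> exists a' : 'I_m, a = (m - a'.+1)%N.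
Proof.
move=> lt_am; have lt_a' : (m - a.+1 < m)%N by lia.
by exists (Ordinal lt_a') => /=; lia.
Qed.

Lemma emx_blockE a b P c d : (c < m)%N -> (d < m)%N -> a != b -> 
  fr c *m em a b P *m fc d =
  if (c == a) && (d == a) then P else
  if (c == a) && (d == b) then 1%:M else
  if (c == b) && (d == a) then 1%:M else
  if (c == b) && (d == b) then 0 else (c == d)%:R%:M.
Proof.
move=> lt_c lt_d ne; have ne' : b != a by rewrite eq_sym.
rewrite -mulmxA.
have [Ed|nda] := eqVneq d a.
  subst d; rewrite emx_bcol_fst // mulmxDr mulmxA !brow_bcol lt_c !andbT (negPf ne) andbF.
  have [Ec|nca] := eqVneq c a; first by rewrite Ec (negPf ne) addr0 mul1mx.
  by case: eqVneq => _; rewrite mul0mx add0r //= raddf0.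
have [Ed|ndb] := eqVneq d b.
  subst d; rewrite emx_bcol_snd // brow_bcol lt_c !andbT.
  have [Ec|nca] //= := eqVneq c a.
  by case: eqVneq => _ //=; rewrite raddf0.
rewrite emx_bcol_id // 1?eq_sym // brow_bcol lt_c !andbT !andbF.
by case: eqP; rewrite // raddf0.
Qed.

Lemma blkdiag1E p P : (p < m)%N -> blkdiag1 m p P = em (m - p.+1) m P.
Proof.
move=> lt_pm; apply: blk_ext => c d lt_c lt_d.
rewrite emx_blockE //; last by lia.
have [[c' Ec] [d' Ed]] := (block_from_bottom lt_c, block_from_bottom lt_d).
rewrite (ltn_eqF lt_c) (ltn_eqF lt_d) !andbF /= Ec Ed brow_of_blk_bcol.
have E (a b : nat) : (a < m)%N -> (b < m)%N -> (m - a.+1 == m - b.+1)%N = (a == b).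
  by move=> *; apply/eqP/eqP; lia.
by rewrite !E ?ltn_ord.
Qed.

Lemma blkdiag2E p P : (p.+1 < m)%N ->
  blkdiag2 m p P 1%:M 1%:M 0 = em (m - p.+1) (m - p.+2) P.
Proof.
move=> lt_pm; apply: blk_ext => c d lt_c lt_d.
rewrite emx_blockE //; last by lia.
have [[c' Ec] [d' Ed]] := (block_from_bottom lt_c, block_from_bottom lt_d).
rewrite Ec Ed brow_of_blk_bcol.
have E (a b : nat) : (a < m)%N -> (b < m)%N -> (m - a.+1 == m - b.+1)%N = (a == b).
  by move=> *; apply/eqP/eqP; lia.
by rewrite !E ?ltn_ord // ltnW.
Qed.

Lemma blkdiag2NE p P : (p.+1 < m)%N ->
  blkdiag2 m p 0 1%:M 1%:M P = em (m - p.+2) (m - p.+1) P.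
Proof.
move=> lt_pm; apply: blk_ext => c d lt_c lt_d.
rewrite emx_blockE //; last by lia.
have [[c' Ec] [d' Ed]] := (block_from_bottom lt_c, block_from_bottom lt_d).
rewrite Ec Ed brow_of_blk_bcol.
have E (a b : nat) : (a < m)%N -> (b < m)%N -> (m - a.+1 == m - b.+1)%N = (a == b).
  by move=> *; apply/eqP/eqP; lia.
rewrite !E ?ltn_ord // 1?ltnW //.
have ex (x : nat) : ~~ ((x == p) && (x == p.+1)) by lia.
move: (ex c') (ex d').
by case: (c' == p :> nat); case: (c' == p.+1 :> nat);
   case: (d' == p :> nat); case: (d' == p.+1 :> nat).
Qed.

Lemma elem_mx_w i P : (i < m)%N ->
  elem_mx m i%:Z P = em (place_w i.+1) (place_w i) P.
Proof.
rewrite /elem_mx; case: i => [|i] lt_im.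
  have -> : (0%:Z == 0) = true by [].
  have lt_pm : (m.-1 < m)%N by lia.
  have e0 : (m - m.-1.+1)%N = 0%N by lia.
  by rewrite (blkdiag1E P lt_pm) e0.
have -> : (i.+1%:Z == 0) = false by [].
have -> : (i.+1%:Z == - m%:Z) = false by lia.
have -> : (0 < i.+1%:Z) = true by [].
have lt_pm : ((m - i.+1 - 1).+1 < m)%N by lia.
have e1 : (m - (m - i.+1 - 1).+1)%N = i.+1 by lia.
have e2 : (m - (m - i.+1 - 1).+2)%N = i by lia.
by have := blkdiag2E P lt_pm; rewrite e1 e2.
Qed.

Lemma elem_mx_v j P : (j < m)%N ->
  elem_mx m (j%:Z - m%:Z) P = em (place_v j.+1) (place_v j) P.
Proof.
rewrite /elem_mx /place_v => lt_jm.
have -> : (j%:Z - m%:Z == 0) = false by lia.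
case: j lt_jm => [|j] lt_jm.
  have -> : (0%:Z - m%:Z == - m%:Z) by lia.
  by rewrite (blkdiag1E P lt_jm) subn0.
have -> : (j.+1%:Z - m%:Z == - m%:Z) = false by lia.
have -> : (0 < j.+1%:Z - m%:Z) = false by lia.
have -> : (m - `|j.+1%:Z - m%:Z|%N - 1 = j)%N by lia.
by rewrite (blkdiag2NE P lt_jm).
Qed.

End BlockUnits.

(** * Indices of one parity and tuple equivalence *)

(** The indices below [q] of the parity of [q - 1], in decreasing order: the
    symmetric complement of a simple admissible tuple of [{0, ..., q}], while
    such a tuple itself is equivalent to [down2 q ++ down2 q.+1]. *)
Fixpoint down2 (q : nat) : seq nat :=
  match q with
  | 0 => [::]
  | 1 => [:: 0%N]
  | q'.+2 => q'.+1 :: down2 q'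
  end.

Arguments down2 : simpl nomatch.

Lemma nat_ind2 (P : nat -> Prop) :
  P 0%N -> P 1%N -> (forall q, P q -> P q.+2) -> forall q, P q.
Proof.
move=> P0 P1 PS q; suff [] : P q /\ P q.+1 by [].
by elim: q => [|q [IH1 IH2]]; split=> //; apply: PS.
Qed.

Lemma mem_down2 q i : (i \in down2 q) = (i < q)%N && (odd i != odd q).
Proof.
elim/nat_ind2: q => [||q IH] /=; rewrite ?in_nil ?mem_seq1 //.
  by case: i => [|[|i]].
by rewrite inE IH; lia.
Qed.

Lemma down2_uniq q : uniq (down2 q).
Proof.
elim/nat_ind2: q => //= q ->; rewrite andbT mem_down2; lia.
Qed.

Lemma perm_down2 q : perm_eq (down2 q ++ down2 q.+1) (iota 0 q.+1).
Proof.
apply: uniq_perm; rewrite ?iota_uniq //.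
  rewrite cat_uniq !down2_uniq /= andbT; apply/hasPn => x.
  by rewrite /= !mem_down2; lia.
move=> x; rewrite mem_cat !mem_down2 mem_iota /=.
lia.
Qed.

(** The SIP, [c0] and [i0] depend only on these subtuples of the entries [i] and
    [i + 1], and interchanging nonadjacent entries does not change them. *)
Definition adj i (u : seq nat) := filter (pred2 i i.+1) u.

Lemma adj_cat i u v : adj i (u ++ v) = adj i u ++ adj i v.
Proof. exact: filter_cat. Qed.

Lemma adj_rev i u : adj i (rev u) = rev (adj i u).
Proof. exact: filter_rev. Qed.

Lemma adj_down2 i q : adj i (down2 q) =
  if odd i != odd q then if (i < q)%N then [:: i] else [::]
  else if (i.+1 < q)%N then [:: i.+1] else [::].
Proof.
case: ifPn => par.
  have E : {in down2 q, pred2 i i.+1 =1 pred1 i}.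
    move=> x; rewrite mem_down2 /= => /andP[_ parx]; case: eqP => //= _.
    by apply/eqP => ex; move: parx par; rewrite ex /=; case: (odd i) (odd q) => [] [].
  rewrite /adj (eq_in_filter E); case: ifPn => lt.
    by rewrite filter_pred1_uniq ?down2_uniq // mem_down2 lt par.
  by apply/eqP; rewrite -[_ == _]negbK -has_filter; apply/hasPn => x;
     rewrite mem_down2 /=; apply: contraTneq => ->; rewrite (negPf lt).
have E : {in down2 q, pred2 i i.+1 =1 pred1 i.+1}.
  move=> x; rewrite mem_down2 /= => /andP[_ parx]; case: eqP => //= ex.
  by move: parx; rewrite ex (negPf par).
rewrite /adj (eq_in_filter E); case: ifPn => lt.
  rewrite filter_pred1_uniq ?down2_uniq // mem_down2 lt /=.
  by move: par; case: (odd i) (odd q) => [] [].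
by apply/eqP; rewrite -[_ == _]negbK -has_filter; apply/hasPn => x;
   rewrite mem_down2 /=; apply: contraTneq => ->; rewrite (negPf lt).
Qed.

Lemma adj_parity i p : adj i (down2 p ++ down2 p.+1) =
  if odd i != odd p then if (i < p)%N then [:: i; i.+1] else [::]
  else if (i < p)%N then [:: i.+1; i] else if i == p then [:: p] else [::].
Proof.
rewrite adj_cat !adj_down2.
have [par|par] := eqVneq (odd i) (odd p).
  have -> : odd i != odd p.+1 by lia.
  rewrite /=; have [->|ne] := eqVneq i p; first by rewrite ltnSn ltnn ltnNge leqnSn.
  have -> : (i.+1 < p)%N = (i < p)%N by lia.
  have -> : (i < p.+1)%N = (i < p)%N by lia.
  by case: ifP.
have -> : (odd i != odd p.+1) = false by lia.
by rewrite ltnS /=; case: ifP.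
Qed.

Lemma tuple_equiv_trans s t u : tuple_equiv s t -> tuple_equiv t u -> tuple_equiv s u.
Proof. by move=> st; elim=> // t' u' a b lt _ IH; apply: tuple_equiv_swap. Qed.

Lemma tuple_equiv_cat v s t : tuple_equiv s t -> tuple_equiv (v ++ s) (v ++ t).
Proof.
elim=> [|t' u' a b lt _ IH]; first exact: tuple_equiv_refl.
by rewrite catA; apply: tuple_equiv_swap => //; rewrite -catA.
Qed.

Lemma tuple_equiv_move a s r : all (fun x => 1 < `|a - x|) s ->
  tuple_equiv (a :: s ++ r) (s ++ a :: r).
Proof.
elim: s => [|x s IH] /=; first by move=> _; exact: tuple_equiv_refl.
case/andP=> lt /IH te; apply: tuple_equiv_trans (tuple_equiv_cat [:: x] te).
exact: (@tuple_equiv_swap _ [::] _ a x lt (tuple_equiv_refl _)).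
Qed.

Lemma tuple_equiv_filter x y s t : `|x - y| <= 1 -> tuple_equiv s t ->
  filter (pred2 x y) s = filter (pred2 x y) t.
Proof.
move=> le1; elim=> // t' u' a b lt _ ->; rewrite !filter_cat /=; congr (_ ++ _).
case: ifPn => Pa; case: ifPn => Pb //.
by move: Pa Pb lt => /orP[] /eqP-> /orP[] /eqP->; lia.
Qed.

Lemma tuple_equiv_perm s t : tuple_equiv s t -> perm_eq s t.
Proof.
elim=> // t' u' a b _ _ /perm_trans; apply; rewrite perm_cat2l.
by rewrite -[[:: a, b & u']]/([:: a] ++ [:: b] ++ u') perm_catCA.
Qed.

Lemma irange_nat (a b : nat) : irange a b = map Posz (iota a (b.+1 - a)).
Proof.
rewrite /irange lez_nat; case: leqP => le; last first.
  by have -> : (b.+1 - a = 0)%N by lia.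
have -> : `|b%:Z - a%:Z|%N.+1 = (b.+1 - a)%N by lia.
rewrite -{3}[a]addn0 iotaDl -map_comp; apply: eq_map => i /=.
by rewrite PoszD.
Qed.

Lemma admissible_csfS p q : (q <= p)%N -> ~~ odd (p - q) ->
  admissible_csf p.+2 q = p.+1%:Z :: p.+2%:Z :: admissible_csf p q.
Proof.
move=> le par; rewrite /admissible_csf.
have -> : ((p.+2 - q)./2 = (p - q)./2.+1)%N by lia.
have iotaS0 n : iota 0 n.+1 = 0%N :: iota 1 n by [].
rewrite iotaS0 map_cons [flatten (_ :: _)]/= -catA.
have -> : irange (p.+2%:Z - 0%:Z - 1) (p.+2%:Z - 0%:Z) = [:: p.+1%:Z; p.+2%:Z].
  have -> : p.+2%:Z - 0%:Z - 1 = p.+1%:Z by lia.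
  have -> : p.+2%:Z - 0%:Z = p.+2%:Z by lia.
  rewrite irange_nat; have -> : (p.+3 - p.+1 = 2)%N by lia.
  by [].
rewrite (iotaDl 1 0) -map_comp.
congr [:: _, _ & flatten _ ++ _]; apply: eq_map => j /=.
by congr irange; lia.
Qed.

(** In [(p-1:p, p-3:p-2, ...)] every entry [p - 2 j] may move to the right past
    the entries [p - 2 j - 3, p - 2 j - 5, ...], none of which is adjacent to it. *)
Lemma tuple_equiv_parity p : tuple_equiv (admissible_csf p (odd p))
  (map Posz (down2 p ++ down2 p.+1)).
Proof.
elim/nat_ind2: p => [||p IH].
- exact: tuple_equiv_refl.
- exact: tuple_equiv_refl.
have -> : odd p.+2 = odd p by rewrite /= negbK.
rewrite admissible_csfS; [|lia|lia].
apply: tuple_equiv_trans (tuple_equiv_cat [:: p.+1%:Z; p.+2%:Z] IH) _.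
rewrite [down2 p.+2]/= [down2 p.+3]/= !map_cat /=.
apply: (tuple_equiv_cat [:: p.+1%:Z]); apply: tuple_equiv_move.
apply/allP => x /mapP[y]; rewrite mem_down2 => /andP[lt par] ->.
lia.
Qed.

Lemma map_Posz_inj s t : map Posz s = map Posz t -> s = t.
Proof. by apply: inj_map => x y []. Qed.

Lemma adj_int i u : map Posz (adj i u) = filter (pred2 i%:Z i.+1%:Z) (map Posz u).
Proof.
rewrite filter_map; congr map; apply: eq_filter => x /=.
Qed.

(** This is what recovers the index [q] from the tuple: below [q] each [i]
    precedes [i + 1], while in the sorted form of index [0] or [1] the
    order is reversed at the parity of [p]. *)
Lemma admissible_csf_filter p q i : (q <= p)%N -> ~~ odd (p - q) -> (i < q)%N ->
  filter (pred2 i%:Z i.+1%:Z) (admissible_csf p q) = [:: i%:Z; i.+1%:Z].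
Proof.
move=> + + lt_iq; move=> le; rewrite -(subnKC le) addKn; move: (p - q)%N => d {p le}.
elim/nat_ind2: d => // [_|d IH].
  rewrite addn0; have -> : admissible_csf q q = irange 0%N%:Z q%:Z.
    by rewrite /admissible_csf subnn.
  rewrite irange_nat -adj_int.
  have -> : (q.+1 - 0 = i + 2 + (q.+1 - i - 2))%N by lia.
  rewrite !iotaD !adj_cat add0n.
  have f0 u : all (fun x => (x != i) && (x != i.+1)) u -> adj i u = [::].
    move=> /allP al; apply/eqP; rewrite -[_ == _]negbK -has_filter.
    by apply/hasPn => x /al; rewrite /= negb_or.
  rewrite (f0 (iota 0 i)); last by apply/allP=> x; rewrite mem_iota; lia.
  rewrite (f0 (iota (i+2) _)); last by apply/allP=> x; rewrite mem_iota; lia.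
  by rewrite /= eqxx /= eqxx orbT.
rewrite /= negbK => par; rewrite !addnS admissible_csfS ?addKn ?leq_addr //=.
rewrite !eqz_nat; have -> : ((q + d).+1 == i) = false by lia.
have -> : ((q + d).+1 == i.+1) = false by lia.
have -> : ((q + d).+2 == i) = false by lia.
have -> : ((q + d).+2 == i.+1) = false by lia.
exact: IH.
Qed.

(** The intervals number [a, ..., a + b - 1] of a canonical form for [p], kept
    general for the inductions. *)
Definition canonical_from (p : nat) (s : nat -> nat) a b : seq nat :=
  flatten [seq iota (s j) ((p - 2 * j).+1 - s j) | j <- iota a b].
Definition canonical_nat p t := exists s, t = canonical_from p s 1 p./2.

Lemma in_canonical_formP p t : in_canonical_form p t ->
  exists2 t', t = map Posz t' & canonical_nat p t'.
Proof.
case=> s ->; exists (canonical_from p s 1 p./2); last by exists s.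
rewrite map_flatten -map_comp; congr flatten; apply/eq_in_map => j.
rewrite mem_iota => lt /=; have -> : p%:Z - (2 * j)%:Z = (p - 2 * j)%N%:Z by lia.
exact: irange_nat.
Qed.

Lemma symcompl_desc p : symcompl_of_index p (odd p) = map Posz (down2 p).
Proof.
elim/nat_ind2: p => // p IH.
rewrite [down2 p.+2]/= map_cons -IH.
have -> : odd p.+2 = odd p by rewrite /= negbK.
rewrite /symcompl_of_index.
have -> : ((p.+2 - odd p)./2 = (p - odd p)./2.+1)%N by lia.
have iotaS0 n : iota 0 n.+1 = 0%N :: iota 1 n by [].
rewrite iotaS0 map_cons (iotaDl 1 0) -map_comp /=.
by congr [:: _ & _ ++ _]; [lia | apply: eq_map => j /=; lia].
Qed.

(** The index of a simple admissible tuple is forced by the parity of [p], and an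
    admissible tuple has only one index; so the complement is [down2 p]. *)
Lemma admissible_data p (w c t : seq int) :
  simple_admissible p w -> symmetric_complement p w c -> in_canonical_form p t ->
  exists w' t', [/\ w = map Posz w', c = map Posz (down2 p), t = map Posz t' &
    [/\ perm_eq w' (iota 0 p.+1),
     tuple_equiv w (map Posz (down2 p ++ down2 p.+1)) & canonical_nat p t']].
Proof.
move=> [q q01 [pw leq par [_ te]]] [q' [_ leq' par' [_ te']] ->].
move=> /in_canonical_formP[t' -> ct].
have Eq : q = odd p by lia.
have te1 : tuple_equiv w (map Posz (down2 p ++ down2 p.+1)).
  by apply: tuple_equiv_trans te _; rewrite Eq; exact: tuple_equiv_parity.
have Eq' : q' = odd p.
  apply/eqP; apply: contraT => neq.
  have lt : (odd p < q')%N by lia.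
  have := admissible_csf_filter leq' par' lt.
  rewrite -(tuple_equiv_filter _ te') ?(tuple_equiv_filter _ te1) //; try lia.
  rewrite -adj_int adj_parity oddb eqxx /=.
  have -> : (odd p < p)%N by lia.
  by case; lia.
have pw' : perm_eq w (map Posz (iota 0 p.+1)).
  by rewrite (perm_trans pw) // irange_nat subn0.
have Ew : w = map Posz (map absz w).
  rewrite -map_comp -[LHS]map_id; apply/eq_in_map => x.
  by rewrite (perm_mem pw') => /mapP[y _ ->].
exists (map absz w), t'; split=> //; first by rewrite Eq' symcompl_desc.
split=> //; have := perm_map absz pw'; rewrite -map_comp.
by rewrite [map (_ \o _) _]map_id.
Qed.

(** * The successor infix property *)

(** Ordering the letters [i], [i + 1] by this relation forbids two consecutive
    [i], which is the SIP for the value [i]. *)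
Definition no_repeat (i : nat) : rel nat := fun x y => ~~ ((x == i) && (y == i)).
Definition adj_SIP u := forall i, sorted (no_repeat i) (adj i u).

Lemma no_repeat_mid i (y u : seq nat) : sorted (no_repeat i) (adj i (i :: u ++ i :: y)) ->
  i.+1 \in u.
Proof.
rewrite -cat1s !adj_cat /adj /= eqxx /=; case E: [seq _ <- u | _] => [|z v] /=.
  by rewrite /no_repeat eqxx.
case/andP; rewrite /no_repeat eqxx /= => ne _.
have : z \in [seq x <- u | pred2 i i.+1 x] by rewrite E mem_head.
by rewrite mem_filter /= (negPf ne) => /andP[/eqP->].
Qed.

Lemma sorted_adj_drop i k u : sorted (no_repeat i) (adj i u) ->
  sorted (no_repeat i) (adj i (drop k u)).
Proof.
rewrite -{1}[u](cat_take_drop k) adj_cat; by case/cat_sorted2.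
Qed.

Lemma adj_SIP_SIP u : adj_SIP u -> SIP (map Posz u).
Proof.
move=> sip a b; rewrite size_map => /andP[lt_ab lt_b].
have lt_a : (a < size u)%N by apply: ltn_trans lt_b.
rewrite !(nth_map 0%N) // => -[eq_ab].
have := sip (nth 0%N u a) => /(sorted_adj_drop a).
rewrite (drop_nth 0%N lt_a) -[drop a.+1 u](cat_take_drop (b - a.+1)) drop_drop subnK //.
rewrite (drop_nth 0%N lt_b) -eq_ab => /no_repeat_mid.
case/(nthP 0%N) => c; rewrite size_take size_drop => lt_c Ec.
exists (c + a.+1)%N; first by move: lt_c; case: ifP; lia.
rewrite (nth_map 0%N); last by move: lt_c; case: ifP; lia.
move: Ec; rewrite nth_take; last by move: lt_c; case: ifP; lia.
by rewrite nth_drop addnC => ->; rewrite -addn1 PoszD.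
Qed.

Lemma adj_iota i s k : adj i (iota s k) = [seq x <- [:: i; i.+1] | (s <= x < s + k)%N].
Proof.
apply: (irr_sorted_eq ltn_trans ltnn).
- by apply: sorted_filter; [exact: ltn_trans | exact: iota_ltn_sorted].
- by apply: sorted_filter; [exact: ltn_trans | rewrite /= ltnSn].
by move=> x; rewrite !mem_filter mem_iota !inE /= andbC.
Qed.

Lemma canonical_from_le p s a b : all (fun x => x <= p - 2 * a)%N (canonical_from p s a b).
Proof.
elim: b a => // b IH a; rewrite /canonical_from /= all_cat; apply/andP; split.
  by apply/allP=> x; rewrite mem_iota; lia.
by apply: sub_all (IH a.+1) => x /=; lia.
Qed.

Lemma canonical_nat_lt p t : canonical_nat p t -> all (fun x => x.+1 < p)%N t.
Proof.
case=> s ->; case: (leqP p 1) => le; first by case: p le => [|[]].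
by apply: sub_all (canonical_from_le p s 1 p./2) => x; lia.
Qed.

(** Each interval contributes [i, i + 1], [i + 1], nothing, or [i] alone if it
    ends at [i]; the last case requires [i] to have the parity of [p], and then
    all later intervals stop below [i]. *)
Lemma canonical_from_adj p s a b i : (a + b <= p./2.+1)%N ->
  sorted (no_repeat i) (adj i (canonical_from p s a b)) /\
  (odd i != odd p -> sorted (no_repeat i) (rcons (adj i (canonical_from p s a b)) i)).
Proof.
elim: b a => [//|b IH] a le_ab; have [|IH1 IH2] := IH a.+1; first by lia.
rewrite /canonical_from /= -/(canonical_from p s a.+1 b) adj_cat adj_iota.
set e := (p - 2 * a)%N; set T := adj i _ in IH1 IH2 *.
have -> : (s a + (e.+1 - s a) = maxn (s a) e.+1)%N by lia.
have R1 x : no_repeat i x i.+1 by rewrite /no_repeat (gtn_eqF (ltnSn i)) andbF.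
have R2 x : no_repeat i i.+1 x by rewrite /no_repeat (gtn_eqF (ltnSn i)).
have P0 U : sorted (no_repeat i) U -> path (no_repeat i) i.+1 U by case: U => //= x U ->; rewrite R2.
have T0 : (e <= i)%N -> T = [::].
  move=> le; have [e0|epos] := posnP e.
    by rewrite /T; have -> : b = 0%N by rewrite /e in e0; lia.
  apply/eqP; rewrite -[_ == _]negbK -has_filter; apply/hasPn => x.
  move/allP: (canonical_from_le p s a.+1 b) => al /al /=.
  by rewrite negb_or; rewrite /e in le epos *; lia.
rewrite /=; case: (leqP (s a) i) => [le_si|lt_is] /=.
  have -> : (s a <= i.+1)%N by lia.
  have -> : (i < maxn (s a) e.+1)%N = (i <= e)%N by lia.
  have -> : (i.+1 < maxn (s a) e.+1)%N = (i < e)%N by lia.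
  case: (ltngtP i e) => [lt|gt|eq] /=.
  - by rewrite R1; split=> [|ne]; apply: P0 => //; apply: IH2.
  - by split.
  - rewrite T0 ?eq //=; split=> //; rewrite /e; lia.
case: ifP => _ /=; last by split.
by split=> [|ne]; apply: P0 => //; apply: IH2.
Qed.

Lemma no_repeat_rev i u : sorted (no_repeat i) (rev u) = sorted (no_repeat i) u.
Proof.
rewrite rev_sorted; apply: eq_sorted => x y; by rewrite /no_repeat andbC.
Qed.

Lemma sorted_cat_cons (T : Type) (e : rel T) u x v :
  sorted e (u ++ x :: v) = sorted e (rcons u x) && path e x v.
Proof. by case: u => //= y u; rewrite cat_path rcons_path /= andbA. Qed.

(** On the letters [i], [i + 1] with [i < p] the middle part [w ++ down2 p]
    reads [i, i + 1, i], or [i + 1, i, i + 1] if [i] has the parity of [p], and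
    the two outer parts are mirror images. *)
Lemma adj_SIP_palindrome p w t : (forall i, adj i w = adj i (down2 p ++ down2 p.+1)) ->
  canonical_nat p t -> adj_SIP (t ++ w ++ down2 p ++ rev t).
Proof.
move=> fw ct i; rewrite !adj_cat adj_rev fw adj_parity adj_down2.
have /allP lt_t := canonical_nat_lt ct.
have T0 : (p <= i.+1)%N -> adj i t = [::].
  move=> le; apply/eqP; rewrite -[_ == _]negbK -has_filter; apply/hasPn => x.
  by move/lt_t; rewrite /= negb_or; lia.
have [s Et] := ct.
have [|S1 S2] := @canonical_from_adj p s 1 p./2 i; first by lia.
rewrite -Et in S1 S2; set T := adj i t in T0 S1 S2 *.
have R1 x : no_repeat i x i.+1 by rewrite /no_repeat (gtn_eqF (ltnSn i)) andbF.
have R2 x : no_repeat i i.+1 x by rewrite /no_repeat (gtn_eqF (ltnSn i)).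
have [par|par] := eqVneq (odd i) (odd p); rewrite /=.
  case: (ltngtP i p) => [lt|gt|eq] /=.
  - have -> : (i.+1 < p)%N by lia.
    rewrite sorted_cat_cons /= R1 R2 /=; apply/andP; split.
      by case: (T) S1 => //= x U S1; rewrite rcons_path S1 R1.
    have : sorted (no_repeat i) (rev T) by rewrite no_repeat_rev.
    by case: (rev T) => //= x U ->; rewrite R2.
  - by rewrite T0 ?ifN //; lia.
  - rewrite T0 ?ifN //; lia.
case: ltnP => [lt|ge] /=; last by rewrite (T0 (leqW ge)).
rewrite sorted_cat_cons S2 //= R1 R2 /=.
by have := S2 par; rewrite -no_repeat_rev rev_rcons.
Qed.

Definition countdown s := rev (iota 0 s.+1).
Lemma countdownS s : countdown s.+1 = s.+1 :: countdown s.
Proof. by rewrite /countdown -addn1 iotaD rev_cat. Qed.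
Lemma size_countdown s : size (countdown s) = s.+1. Proof. by rewrite size_rev size_iota. Qed.

(** A maximality that is easier to propagate than the value of [i0] itself. *)
Definition is_i0 (g : seq nat) s := subseq (countdown s) g && ~~ subseq (countdown s.+1) g.

Lemma subseq_Posz (u v : seq nat) : subseq (map Posz u) (map Posz v) = subseq u v.
Proof.
apply/idP/idP => [|]; last exact: map_subseq.
move/(map_subseq absz); rewrite -!map_comp.
by rewrite !(@eq_map _ _ (absz \o Posz) id) // !map_id.
Qed.

Lemma subseq_countdown_mono s s' g : (s <= s')%N ->
  subseq (countdown s') g -> subseq (countdown s) g.
Proof.
elim: s' => [|s' IH]; first by rewrite leqn0 => /eqP->.
rewrite leq_eqVlt => /orP[/eqP->//|lt]; rewrite countdownS => /(subseq_trans _) sub.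
by apply: IH => //; apply: sub; apply: subseq_cons.
Qed.

Lemma is_i0_i0 g s : is_i0 g s -> i0 (map Posz g) = s.
Proof.
case/andP=> sub nsub; apply/eqP; rewrite eqn_leq; apply/andP; split.
  apply/bigmax_leqP => -[s' lt] /=.
  rewrite irange_nat subn0 -map_rev subseq_Posz => sub'.
  by rewrite leqNgt; apply: contra nsub => le; apply: subseq_countdown_mono sub'.
have lt : (s < size (map Posz g))%N by rewrite size_map -size_countdown size_subseq.
rewrite /i0 (bigD1 (Ordinal lt)) /= ?leq_maxl //.
by rewrite irange_nat subn0 -map_rev subseq_Posz.
Qed.

Lemma c0_rev g : c0 (map Posz g) = i0 (map Posz (rev g)).
Proof.
rewrite /c0 /i0 map_rev size_rev; apply: eq_bigl => s.
by rewrite subseq_rev.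
Qed.

(** The effect on [i0] of prepending the index [i]. *)
Definition i0_step i s := if i == s.+1 then s.+1 else s.

Lemma is_i0_cons i g s : is_i0 g s -> is_i0 (i :: g) (i0_step i s).
Proof.
rewrite /i0_step /is_i0 => /andP[sub nsub]; case: eqP => [->|ne].
  rewrite !countdownS; move: nsub; rewrite !countdownS /= eqxx sub /=.
  rewrite (gtn_eqF (ltnSn _)) => nsub; apply: contra nsub => /(subseq_trans _); apply.
  exact: subseq_cons.
rewrite (subseq_trans sub (subseq_cons _ _)) /=.
by rewrite countdownS /= eq_sym; case: eqP => // _; rewrite -countdownS.
Qed.

Lemma is_i0_cat t g s : is_i0 g s -> is_i0 (t ++ g) (foldr i0_step s t).
Proof. by move=> I; elim: t => //= i t; apply: is_i0_cons. Qed.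

Lemma subseq_adj i u v : subseq u v -> subseq (adj i u) (adj i v).
Proof.
by move=> sub; rewrite subseq_filter filter_all (subseq_trans (filter_subseq _ _)).
Qed.

Lemma is_i0_parity p w : ~~ odd p -> (forall i, adj i w = adj i (down2 p ++ down2 p.+1)) ->
  is_i0 w (1 < p)%N.
Proof.
move=> par fw; rewrite /is_i0; case: ltnP => lt.
  have f0 : adj 0 w = [:: 1; 0]%N by rewrite fw adj_parity /= eq_sym (negPf par) /= ifT //; lia.
  have f1 : adj 1 w = [:: 1; 2]%N by rewrite fw adj_parity /= (negPf par) /= lt.
  apply/andP; split; first by rewrite -[countdown _]f0 filter_subseq.
  by apply/negP => /(subseq_adj 1); rewrite f1.
have f0 : adj 0 w = [:: 0]%N.
  by rewrite fw adj_parity /= eq_sym (negPf par) /=; case: p lt par {fw} => [|[]].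
apply/andP; split; first by rewrite -[countdown _]f0 filter_subseq.
by apply/negP => /(subseq_adj 0); rewrite f0.
Qed.

Lemma subseq_cat_notin (T : eqType) x (s a b : seq T) : x \notin a ->
  subseq (x :: s) (a ++ b) -> subseq (x :: s) b.
Proof.
elim: a => [//|y a IH]; rewrite inE negb_or => /andP[ne nin].
by rewrite cat_cons [subseq _ (_ :: _)]/= (negPf ne); apply: IH.
Qed.

(** Reading from the right, the chain [0, 1] ends in the complement, where
    [2] does not occur; this is why [c0] of the right part equals [i0] of
    the left part. *)
Lemma is_i0_rev_parity p w : ~~ odd p -> (forall i, adj i w = adj i (down2 p ++ down2 p.+1)) ->
  is_i0 (rev (down2 p) ++ rev w) (1 < p)%N.
Proof.
move=> par fw; rewrite /is_i0; case: ltnP => lt.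
  have f0 : adj 0 w = [:: 1; 0]%N by rewrite fw adj_parity /= eq_sym (negPf par) /= ifT //; lia.
  apply/andP; split.
    rewrite -[countdown _]/([:: 1%N] ++ [:: 0%N]); apply: cat_subseq; rewrite sub1seq mem_rev.
      by rewrite mem_down2 lt par.
    by have : 0%N \in adj 0 w; [rewrite f0 | rewrite mem_filter => /andP[]].
  apply/negP; rewrite -[countdown _]/[:: 2; 1; 0]%N => /subseq_cat_notin sub.
  have /sub/(subseq_adj 0) : 2%N \notin rev (down2 p) by rewrite mem_rev mem_down2; lia.
  by rewrite adj_rev f0.
have f0 : adj 0 w = [:: 0]%N.
  by rewrite fw adj_parity /= eq_sym (negPf par) /=; case: p lt par {fw} => [|[]].
have -> : down2 p = [::] by case: p lt par {fw} => [|[]].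
rewrite cat0s; apply/andP; split.
  by rewrite -[countdown _]/(rev [:: 0%N]) -f0 -adj_rev filter_subseq.
by apply/negP => /(subseq_adj 0); rewrite adj_rev f0.
Qed.

Lemma i0_c0_steps p w t : ~~ odd p -> (forall i, adj i w = adj i (down2 p ++ down2 p.+1)) ->
  i0 (map Posz (t ++ w)) = foldr i0_step (1 < p)%N t /\
  c0 (map Posz (w ++ down2 p ++ rev t)) = foldr i0_step (1 < p)%N t.
Proof.
move=> par fw; split; first by apply: is_i0_i0; apply: is_i0_cat; apply: is_i0_parity.
rewrite c0_rev !rev_cat revK -catA.
by apply: is_i0_i0; apply: is_i0_cat; apply: is_i0_rev_parity.
Qed.

(** If [i = s], the SIP would put an [i + 1] before the first [i] of [u],
    which extends the decreasing chain [i, ..., 0] of [u]. *)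
Lemma adj_SIP_cons_neq i u s : sorted (no_repeat i) (adj i (i :: u)) -> is_i0 u s -> i != s.
Proof.
move=> sip /andP[sub nsub]; apply: contra nsub => /eqP Ei; subst s.
have Ed : countdown i = i :: behead (countdown i) by rewrite /countdown -addn1 iotaD rev_cat.
have i_u : i \in u by apply: (mem_subseq sub); rewrite Ed mem_head.
have Eu : u = take (index i u) u ++ i :: drop (index i u).+1 u.
  by rewrite -{2}(nth_index 0%N i_u) -drop_nth ?cat_take_drop ?index_mem.
set u1 := take _ u in Eu; have ni : i \notin u1.
  by apply/negP => /index_ltn; rewrite ltnn.
have i1 : i.+1 \in u1 by move: sip; rewrite [in X in X -> _]Eu => /no_repeat_mid.
rewrite countdownS -cat1s [X in subseq _ X]Eu; apply: cat_subseq; first by rewrite sub1seq.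
by move: sub; rewrite [X in subseq _ X]Eu Ed; apply: subseq_cat_notin.
Qed.

(** * Products of elementary matrices *)

Section Products.

Variables (R : comUnitRingType) (m n : nat).
Local Notation fc := (bcol R m n).
Local Notation fr := (brow R m n).
Local Notation em := (@emx R m n).
Local Notation pairs := (seq (nat * 'M[R]_n)).

(** The list pairs each index with its matrix; [psi] tells which blocks the
    indices act on, so that both ranges of indices are treated alike. *)
Definition emx_prod (psi : nat -> nat) (l : pairs) : 'M[R]_(m * n) :=
  \big[mulmx/1%:M]_(x <- l) em (psi x.1.+1) (psi x.1) x.2.

Lemma emx_prod_nil psi : emx_prod psi [::] = 1%:M.
Proof. by rewrite /emx_prod big_nil. Qed.

Lemma emx_prod_cons psi x l :
  emx_prod psi (x :: l) = em (psi x.1.+1) (psi x.1) x.2 *m emx_prod psi l.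
Proof. by rewrite /emx_prod big_cons. Qed.

Lemma emx_prod_cat psi l1 l2 : emx_prod psi (l1 ++ l2) = emx_prod psi l1 *m emx_prod psi l2.
Proof. by elim: l1 => [|x l IH]; rewrite ?emx_prod_nil ?mul1mx //= !emx_prod_cons IH mulmxA. Qed.

Lemma emx_prod1 psi x : emx_prod psi [:: x] = em (psi x.1.+1) (psi x.1) x.2.
Proof. by rewrite emx_prod_cons emx_prod_nil mulmx1. Qed.

Lemma emx_prod_id psi l c :
  (forall i, i \in unzip1 l -> psi i.+1 != c /\ psi i != c) ->
  emx_prod psi l *m fc c = fc c /\ fr c *m emx_prod psi l = fr c.
Proof.
elim: l => [|x l IH] H; first by rewrite emx_prod_nil mul1mx mulmx1.
have [|E1 E2] := IH; first by move=> i il; apply: H; rewrite /= inE il orbT.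
have [n1 n2] := H x.1 (mem_head _ _).
by rewrite emx_prod_cons -mulmxA E1 emx_bcol_id // mulmxA brow_emx_id.
Qed.

Lemma mulmx_big_comm (I : eqType) N (F : I -> 'M[R]_N) (M : 'M[R]_N) s :
  (forall i, i \in s -> M *m F i = F i *m M) ->
  M *m (\big[mulmx/1%:M]_(i <- s) F i) = (\big[mulmx/1%:M]_(i <- s) F i) *m M.
Proof.
elim: s => [|i s IH] H; first by rewrite big_nil mulmx1 mul1mx.
rewrite big_cons mulmxA H ?mem_head // -!mulmxA IH // => j js.
by apply: H; rewrite inE js orbT.
Qed.

Lemma emx_prod_comm psi phi l1 l2 :
  (forall i j, i \in unzip1 l1 -> j \in unzip1 l2 ->
     [&& (psi i != phi j) || (m <= psi i)%N, psi i != phi j.+1,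
         psi i.+1 != phi j & psi i.+1 != phi j.+1]) ->
  emx_prod psi l1 *m emx_prod phi l2 = emx_prod phi l2 *m emx_prod psi l1.
Proof.
move=> H; apply: mulmx_big_comm => y yl; apply/esym; apply: mulmx_big_comm => x xl; apply/esym.
have /and4P[? ? ? ?] := H _ _ (map_f fst xl) (map_f fst yl).
exact: emx_comm.
Qed.

Definition tr_pairs (l : pairs) : pairs := [seq (x.1, x.2^T) | x <- l].

Lemma tr_emx_prod psi l : (emx_prod psi l)^T = emx_prod psi (rev (tr_pairs l)).
Proof.
elim: l => [|x l IH]; first by rewrite !emx_prod_nil trmx1.
by rewrite emx_prod_cons trmx_mul tr_emx IH /= rev_cons -cats1 emx_prod_cat emx_prod1.
Qed.

Lemma unzip1_tr_pairs l : unzip1 (tr_pairs l) = unzip1 l.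
Proof. by rewrite /unzip1 -map_comp. Qed.

(** * Block symmetry *)

Definition block_sym (M : 'M[R]_(m * n)) :=
  forall a b, fr a *m M *m fc b = fr b *m M *m fc a.

Lemma block_sym_blktr M : block_sym M -> blktr M = M.
Proof.
move=> sM; apply: blk_ext => a b /block_from_bottom[a' ->] /block_from_bottom[b' ->].
by rewrite /blktr brow_of_blk_bcol blkE sM.
Qed.

Lemma block_sym_out (M : 'M[R]_(m * n)) c d : (m <= d)%N ->
  fr c *m M *m fc d = fr d *m M *m fc c.
Proof. by move=> le; rewrite (@brow_out R m n d le) (@bcol_out R m n d le) !mul0mx mulmx0. Qed.

Lemma block_sym_emx a b P : a != b -> block_sym (em a b P).
Proof.
move=> ne c d; have [lc|?] := ltnP c m; last by rewrite -block_sym_out.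
have [ld|?] := ltnP d m; last by rewrite block_sym_out.
rewrite !emx_blockE // (eq_sym d c).
by case: (c == a); case: (d == a); case: (c == b); case: (d == b).
Qed.

Lemma brow_bcolC a b : fr a *m fc b = fr b *m fc a.
Proof. by rewrite !brow_bcol eq_sym; case: eqP => // ->. Qed.

(** Each block is fixed by one of the two commuting factors, so one factor
    disappears from every entry of the product. *)
Lemma block_sym_mul G D : block_sym G -> block_sym D -> G *m D = D *m G ->
  (forall c, (G *m fc c = fc c /\ fr c *m G = fr c) \/
             (D *m fc c = fc c /\ fr c *m D = fr c)) -> block_sym (G *m D).
Proof.
move=> sG sD GD fix_ a b.
have aux (x y : nat) (M N : 'M[R]_(m * n)) :
    fr x *m M = fr x -> N *m fc y = fc y -> fr x *m (M *m N) *m fc y = fr x *m fc y.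
  by move=> xM Ny; rewrite mulmxA xM -mulmxA Ny.
case: (fix_ a) (fix_ b) => [[Ga aG]|[Da aD]] [[Gb bG]|[Db bD]].
- by rewrite !mulmxA aG bG.
- by rewrite aux // GD aux // brow_bcolC.
- by rewrite [RHS]aux // GD aux // brow_bcolC.
- by rewrite -!mulmxA Da Db !mulmxA.
Qed.

(** The rows [a] and [b] of the product mix [X] only with row [a] of [S].  Its
    blocks are scalar, hence commute with [X], and the two possible products
    [X S_aa] and [X S_ab] vanish. *)
Lemma block_sym_step a b X S : (a < m)%N -> a != b -> block_sym S ->
  (forall c, exists s, fr a *m S *m fc c = s%:M) ->
  fr a *m S *m fc a = 0 -> fr a *m S *m fc b = 0 ->
  block_sym (em a b X *m S *m em a b X).
Proof.
move=> lt_a ne sS scal Saa Sab.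
have Sba : fr b *m S *m fc a = 0 by rewrite sS.
have eqE c d : fr c *m (em a b X *m S *m em a b X) *m fc d =
  (fr c *m em a b X) *m S *m (em a b X *m fc d) by rewrite !mulmxA.
have rowa M : (X *m fr a + fr b) *m S *m M = X *m (fr a *m S *m M) + fr b *m S *m M :> 'M_n.
  by rewrite !mulmxDl -!mulmxA.
have cola M : M *m S *m (fc a *m X + fc b) = (M *m S *m fc a) *m X + M *m S *m fc b :> 'M_n.
  by rewrite mulmxDr !mulmxA.
have caseA d : fr a *m (em a b X *m S *m em a b X) *m fc d =
   fr d *m (em a b X *m S *m em a b X) *m fc a.
  have [->//|nda] := eqVneq d a.
  have [Ed|ndb] := eqVneq d b.
    subst d; have [lt_b|le] := ltnP b m; last by rewrite block_sym_out.
    by rewrite !eqE brow_emx_fst // emx_bcol_fst // brow_emx_snd // emx_bcol_snd //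
      rowa cola Saa Sba Sab mulmx0 mul0mx.
  rewrite !eqE brow_emx_fst // emx_bcol_fst // brow_emx_id ?emx_bcol_id 1?eq_sym //
    rowa cola (sS d a) (sS d b).
  by have [s ->] := scal d; rewrite scalar_mxC.
move=> c d; have [->|nca] := eqVneq c a; first exact: caseA.
have [->|nda] := eqVneq d a; first by rewrite caseA.
have [lt_b|le_b] := ltnP b m; last first.
  have [->|ncb] := eqVneq c b; first by rewrite -block_sym_out.
  have [->|ndb] := eqVneq d b; first by rewrite block_sym_out.
  by rewrite !eqE !brow_emx_id ?emx_bcol_id 1?eq_sym.
have colb e : e != a -> em a b X *m fc e = fc (if e == b then a else e).
  by move=> nea; case: eqVneq => [->|neb]; rewrite ?emx_bcol_snd // emx_bcol_id // eq_sym.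
have rowb e : e != a -> fr e *m em a b X = fr (if e == b then a else e).
  by move=> nea; case: eqVneq => [->|neb]; rewrite ?brow_emx_snd // brow_emx_id // eq_sym.
by rewrite !eqE !rowb // !colb.
Qed.

End Products.

(** What [place_w] and [place_v] have in common. *)
Definition layout (m : nat) (psi : nat -> nat) :=
  [/\ psi 0%N = m, forall i, (i < m)%N -> (psi i.+1 < m)%N
    & forall i j, (i <= m)%N -> (j <= m)%N -> (psi i == psi j) = (i == j)].

Section Side.

Variables (R : comUnitRingType) (m n : nat) (psi : nat -> nat).
Local Notation fc := (bcol R m n).
Local Notation fr := (brow R m n).
Local Notation em := (@emx R m n).
Local Notation pairs := (seq (nat * 'M[R]_n)).
Local Notation emx_prod := (@emx_prod R m n psi).
Hypothesis layout_psi : layout m psi.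
Let psi0 : psi 0%N = m. Proof. by case: layout_psi. Qed.
Let psi_lt i : (i < m)%N -> (psi i.+1 < m)%N.
Proof. by case: layout_psi => _ H _; apply: H. Qed.
Let psi_inj i j : (i <= m)%N -> (j <= m)%N -> (psi i == psi j) = (i == j).
Proof. by case: layout_psi => _ _; apply. Qed.

Definition parity_prod q (X : nat -> 'M[R]_n) := emx_prod [seq (i, X i) | i <- down2 q].

Lemma psi_ne i : (i < m)%N -> psi i.+1 != psi i.
Proof. by move=> lt; rewrite psi_inj ?gtn_eqF // ltnW. Qed.

Lemma unzip1_down2 q (X : nat -> 'M[R]_n) : unzip1 [seq (i, X i) | i <- down2 q] = down2 q.
Proof. by rewrite /unzip1 -map_comp map_id. Qed.

Lemma parity_prodSS q X : parity_prod q.+2 X = em (psi q.+2) (psi q.+1) (X q.+1) *m parity_prod q X.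
Proof. by rewrite /parity_prod /= emx_prod_cons. Qed.

Lemma parity_prod_id q X j : (q < j <= m)%N ->
  parity_prod q X *m fc (psi j) = fc (psi j) /\ fr (psi j) *m parity_prod q X = fr (psi j).
Proof.
move=> /andP[lt le]; apply: emx_prod_id => i; rewrite unzip1_down2 mem_down2 => /andP[lti _].
by rewrite !psi_inj; lia.
Qed.

(** The indices in [down2 q] act on disjoint pairs of blocks. *)
Lemma parity_prod_bcol q X i : (q <= m)%N -> (i < q)%N -> odd i != odd q ->
  parity_prod q X *m fc (psi i.+1) = fc (psi i.+1) *m X i + fc (psi i) /\
  ((0 < i)%N -> parity_prod q X *m fc (psi i) = fc (psi i.+1)).
Proof.
elim/nat_ind2: q => [//|le1|q IH le_qm].
  case: i => // _ _; split=> //; rewrite /parity_prod /= emx_prod1 /=.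
  by apply: emx_bcol_fst; [exact: psi_lt | exact: psi_ne].
move=> lt par; rewrite parity_prodSS; have [Ei|ne] := eqVneq i q.+1.
  subst i; rewrite -!mulmxA !(proj1 (parity_prod_id _ _)); try lia.
  split=> [|_]; first by apply: emx_bcol_fst; [exact: psi_lt | exact: psi_ne].
  by apply: emx_bcol_snd; [apply: psi_lt; lia | exact: psi_ne].
have [|||E1 E2] := IH; try lia.
split=> [|i0]; rewrite -mulmxA.
  rewrite E1 mulmxDr mulmxA emx_bcol_id ?psi_inj; try lia.
  have [->|i_gt] := posnP i; first by rewrite psi0 (@bcol_out R m n m (leqnn m)) mulmx0.
  by rewrite emx_bcol_id ?psi_inj //; lia.
by rewrite E2 // emx_bcol_id ?psi_inj //; lia.
Qed.

Lemma parity_prod_rev q X : (q <= m)%N ->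
  emx_prod (rev [seq (i, X i) | i <- down2 q]) = parity_prod q X.
Proof.
elim/nat_ind2: q => // q IH le.
rewrite /= rev_cons -cats1 emx_prod_cat IH; last by lia.
rewrite emx_prod1 parity_prodSS -(@emx_prod1 R m n psi (q.+1, X q.+1)); apply: emx_prod_comm => i j.
rewrite unzip1_down2 mem_down2 mem_seq1 => /andP[? ?] /eqP-> /=.
by rewrite !psi_inj; lia.
Qed.

Lemma tr_parity_prod q X : (q <= m)%N ->
  (parity_prod q X)^T = parity_prod q (fun i => (X i)^T).
Proof.
by move=> le; rewrite tr_emx_prod /tr_pairs -map_comp parity_prod_rev.
Qed.

Lemma brow_parity_prod q X i : (q <= m)%N -> (i < q)%N -> odd i != odd q -> (0 < i)%N ->
  fr (psi i) *m parity_prod q X = fr (psi i.+1).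
Proof.
move=> le lt par i0; apply: trmx_inj; rewrite trmx_mul tr_parity_prod // !tr_brow.
exact: (proj2 (parity_prod_bcol _ _ _ _)).
Qed.

Lemma block_sym_parity_prod q X : (q <= m)%N -> block_sym (parity_prod q X).
Proof.
elim/nat_ind2: q => [_|le1|q IH le].
- by rewrite /parity_prod /= emx_prod_nil => a b; rewrite !mulmx1 brow_bcolC.
- by rewrite /parity_prod /= emx_prod1; apply: block_sym_emx; apply: psi_ne.
rewrite parity_prodSS; apply: block_sym_mul.
- exact: block_sym_emx (psi_ne _).
- by apply: IH; lia.
- rewrite -(@emx_prod1 R m n psi (q.+1, X q.+1)); apply: emx_prod_comm => i j.
  rewrite unzip1_down2 mem_down2 mem_seq1 => /eqP-> /andP[? ?] /=.
  by rewrite !psi_inj; lia.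
move=> c; have [cq|ncq] := boolP ((c == psi q.+2) || (c == psi q.+1)).
  by right; case/orP: cq => /eqP->; apply: parity_prod_id; lia.
by left; move: ncq; rewrite negb_or => /andP[? ?]; rewrite emx_bcol_id ?brow_emx_id // eq_sym.
Qed.

(** The condition of [block_sym_step] on row [k], in a form which survives the
    subsequent steps: the row lives on the places beyond [e] only. *)
Definition scalar_row (S : 'M[R]_(m * n)) k e :=
  (forall c, exists s, fr (psi k) *m S *m fc c = s%:M) /\
  (forall j, (j <= e)%N -> fr (psi k) *m S *m fc (psi j) = 0).

Lemma scalar_row_unit S k k' e : fr (psi k) *m S = fr (psi k') ->
  (e < k' <= m)%N -> scalar_row S k e.
Proof.
move=> E /andP[lt le]; split=> [c|j lej]; rewrite E brow_bcol.
  by case: ifP; [exists 1 | exists 0; rewrite raddf0].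
by rewrite psi_inj //; [rewrite gtn_eqF //; lia | lia].
Qed.

(** After a step the row that has been used reappears, unchanged, at the next
    lower place, and the rows above it keep their property. *)
Lemma scalar_row_step i X S e : (i < m)%N -> (i < e)%N -> scalar_row S i.+1 e -> block_sym S ->
  let S' := em (psi i.+1) (psi i) X *m S *m em (psi i.+1) (psi i) X in
  [/\ block_sym S', (0 < i)%N -> scalar_row S' i e &
      forall k, (i.+1 < k <= m)%N -> scalar_row S k k -> scalar_row S' k k].
Proof.
move=> lt_im lt_ie [scal zero] sS S'; set E := em _ _ _ in S' *.
have ne := psi_ne lt_im.
have colE (r : 'M[R]_(n, m * n)) : 
    (forall c, exists s, r *m fc c = s%:M) -> 
    r *m fc (psi i.+1) = 0 -> r *m fc (psi i) = 0 ->
    forall c, (exists s, r *m E *m fc c = s%:M) /\ (r *m fc c = 0 -> r *m E *m fc c = 0).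
  move=> sc r1 r0 c; rewrite -mulmxA.
  have z : exists s, 0 = s%:M :> 'M[R]_n by exists 0; rewrite raddf0.
  have [->|nc1] := eqVneq c (psi i.+1).
    rewrite emx_bcol_fst ?psi_lt // mulmxDr mulmxA r1 r0 mul0mx addr0.
    by [].
  have [Ec|nc0] := eqVneq c (psi i); last by rewrite emx_bcol_id 1?eq_sym.
  have [i0|i0] := posnP i.
    rewrite Ec i0 psi0 (@bcol_out R m n m (leqnn m)) !mulmx0.
    by [].
  have lt_i : (psi i < m)%N by case: (i) i0 lt_im => // ? _ /ltnW; apply: psi_lt.
  rewrite Ec emx_bcol_snd // r1.
split.
- by apply: block_sym_step => //; [exact: psi_lt | apply: zero; lia | apply: zero; lia].
- move=> i0; have lt_i : (psi i < m)%N by case: (i) i0 lt_im => // ? _ /ltnW; apply: psi_lt.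
  have H := colE _ scal (zero _ lt_ie) (zero _ (ltnW lt_ie)).
  have E' : fr (psi i) *m S' = fr (psi i.+1) *m S *m E by rewrite /S' !mulmxA brow_emx_snd.
  split=> [c|j lej]; rewrite E'; first by case: (H c).
  by case: (H (psi j)) => _; apply; apply: zero.
move=> k /andP[ltk lek] [scalk zerok].
have H := colE _ scalk (zerok i.+1 (ltnW ltk)) (zerok i (ltnW (ltnW ltk))).
have E' : fr (psi k) *m S' = fr (psi k) *m S *m E.
  by rewrite /S' !mulmxA brow_emx_id ?psi_inj //; lia.
split=> [c|j lej]; rewrite E'; first by case: (H c).
by case: (H (psi j)) => _; apply; apply: zerok.
Qed.

Definition nest (l : pairs) S := emx_prod l *m S *m emx_prod (rev l).

Lemma nest_cons x l S : nest (x :: l) S =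
  em (psi x.1.+1) (psi x.1) x.2 *m nest l S *m em (psi x.1.+1) (psi x.1) x.2.
Proof. by rewrite /nest emx_prod_cons rev_cons -cats1 emx_prod_cat emx_prod1 !mulmxA. Qed.

Lemma nest_cat l1 l2 S : nest (l1 ++ l2) S = nest l1 (nest l2 S).
Proof. by rewrite /nest rev_cat !emx_prod_cat !mulmxA. Qed.

Lemma nest_nil S : nest [::] S = S.
Proof. by rewrite /nest emx_prod_nil mul1mx mulmx1. Qed.

(** An interval [(s : e)] carries the row of place [e + 1] down to place [s],
    so one row serves all steps of the interval. *)
Lemma nest_interval s k l S : unzip1 l = iota s k -> (s + k <= m)%N ->
  block_sym S -> scalar_row S (s + k) (s + k) ->
  [/\ block_sym (nest l S), (0 < s)%N -> scalar_row (nest l S) s (s + k) &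
      forall j, (s + k < j <= m)%N -> scalar_row S j j -> scalar_row (nest l S) j j].
Proof.
elim: k s l => [|k IH] s [|x l] //=.
  by rewrite addn0 nest_nil => _ _.
case=> xs ul; rewrite -addSnnS => le sS rS.
have [b1 b2 b3] := IH _ _ ul le sS rS.
rewrite nest_cons xs.
have [||c1 c2 c3] := scalar_row_step (i := s) x.2 _ _ (b2 isT) b1; try lia.
split=> // j lt rj; apply: c3; first by lia.
exact: b3.
Qed.

(** The intervals are nested from the last one outwards and their right ends
    increase, so the row needed by each interval has not been used before. *)
Lemma nest_canonical p s a b l S : (p < m)%N -> (0 < a)%N -> (a + b <= p./2.+1)%N ->
  unzip1 l = canonical_from p s a b -> block_sym S ->
  (forall e, odd e = odd p -> (e.+1 < p)%N -> scalar_row S e.+1 e.+1) ->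
  block_sym (nest l S) /\
  (forall k, (p.+1 < k + 2 * a)%N -> (k <= m)%N -> scalar_row S k k -> scalar_row (nest l S) k k).
Proof.
move=> lt_pm; elim: b a l => [|b IH] a l a0 le ul sS rS.
  by case: l ul => // _; rewrite nest_nil.
move: ul; rewrite /canonical_from /= -/(canonical_from p s a.+1 b).
set k := (_ - s a)%N => ul.
have El : l = take k l ++ drop k l by rewrite cat_take_drop.
have sz : size (iota (s a) k) = k by rewrite size_iota.
have u1 : unzip1 (take k l) = iota (s a) k.
  by rewrite /unzip1 map_take -/(unzip1 l) ul take_size_cat.
have u2 : unzip1 (drop k l) = canonical_from p s a.+1 b.
  by rewrite /unzip1 map_drop -/(unzip1 l) ul drop_size_cat.
have [|b1 b2] := IH a.+1 (drop k l) isT _ u2 sS rS; first by lia.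
rewrite El nest_cat; have [k0|kpos] := posnP k.
  have -> : take k l = [::] by rewrite k0 take0.
  by rewrite nest_nil; split=> // j lt le_j rj; apply: b2 => //; lia.
have Ek : (s a + k = (p - 2 * a).+1)%N by rewrite /k in kpos *; lia.
have r0 : scalar_row (nest (drop k l) S) (s a + k) (s a + k).
  by rewrite Ek; apply: b2; [lia | lia | apply: rS; lia].
have [|c1 c2 c3] := nest_interval u1 _ b1 r0; first by lia.
split=> // j lt le_j rj; apply: c3; first by lia.
by apply: b2 => //; lia.
Qed.

Lemma nest_down2 q X S : (q <= m)%N -> block_sym S ->
  (forall i, i \in down2 q -> scalar_row S i.+1 i.+1) ->
  block_sym (nest [seq (i, X i) | i <- down2 q] S) /\
  (forall k, (q < k <= m)%N -> scalar_row S k k ->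
     scalar_row (nest [seq (i, X i) | i <- down2 q] S) k k).
Proof.
elim/nat_ind2: q => [_|le1|q IH le] sS rS; first by rewrite /= nest_nil.
  rewrite /= nest_cons nest_nil /=.
  have r1 : scalar_row S 1 1 by apply: rS.
  by have [||b1 b2 b3] := scalar_row_step (i := 0) (X 0%N) _ _ r1 sS; try lia; split.
have [|||b1 b2] := IH; first by lia.
- by [].
- by move=> i iq; apply: rS; rewrite /= inE iq orbT.
rewrite /= nest_cons /=.
have rq : scalar_row (nest [seq (i, X i) | i <- down2 q] S) q.+2 q.+2.
  by apply: b2; [lia | apply: rS; rewrite /= mem_head].
have [||c1 c2 c3] := scalar_row_step (i := q.+1) (X q.+1) _ _ rq b1; try lia.
by split=> // k lt rk; apply: c3 => //; apply: b2 => //; lia.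
Qed.

(** In [M_c], and in [M_w M_c], the row of a place [e + 1] with [e] of the parity
    of [p] is a single identity block at a higher place, because the indices in
    [down2 p] and [down2 p.+1] shift it upwards. *)
Theorem block_sym_nest p l X : (p < m)%N -> canonical_nat p (unzip1 l) ->
  block_sym (nest l (parity_prod p X)) /\
  block_sym (nest l (parity_prod p X *m parity_prod p.+1 X *m parity_prod p X)).
Proof.
move=> lt_pm [s ul].
have Ed e : odd e = odd p -> (e.+1 < p)%N -> fr (psi e.+1) *m parity_prod p X = fr (psi e.+2).
  by move=> par lt; apply: brow_parity_prod; rewrite /= ?par; lia.
have Er e : odd e != odd p -> (e < p)%N -> fr (psi e.+1) *m parity_prod p.+1 X = fr (psi e.+2).
  by move=> par lt; apply: brow_parity_prod => //=; move: par; case: (odd e) (odd p) => [] [].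
split; apply: (proj1 (nest_canonical lt_pm (isT : 0 < 1)%N _ ul _ _)) => //.
- by apply: block_sym_parity_prod; lia.
- by move=> e par lt; apply: scalar_row_unit (Ed e par lt) _; lia.
- have -> : parity_prod p X *m parity_prod p.+1 X *m parity_prod p X
             = nest [seq (i, X i) | i <- down2 p] (parity_prod p.+1 X).
    by rewrite /nest parity_prod_rev //; lia.
  apply: (proj1 (nest_down2 _ _ _ _)); first by lia.
    exact: block_sym_parity_prod.
  move=> i; rewrite mem_down2 => /andP[lt par].
  by apply: scalar_row_unit (Er i par lt) _; lia.
move=> e par lt; have [lt3|ge3] := ltnP e.+3 p.
  apply: (@scalar_row_unit _ _ e.+4); last by lia.
  by rewrite !mulmxA Ed // Er ?Ed /= ?negbK ?par //; lia.
have [E2|ne2] := eqVneq e.+2 p; last first.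
  by exfalso; lia.
apply: (@scalar_row_unit _ _ e.+3); last by lia.
rewrite !mulmxA Ed // Er; [|by rewrite /= par; case: (odd p)|by lia].
by apply: (proj2 (parity_prod_id _ _)); lia.
Qed.

End Side.

(** * Linearization by a block tridiagonal pencil *)

Section Tridiagonal.

Variables (R : comUnitRingType) (m n : nat) (x : R).
Local Notation fc := (bcol R m n).
Local Notation fr := (brow R m n).
Hypothesis m0 : (0 < m)%N.

(** The columns of [X O' - Q'], where [O'] collects all odd and [Q'] all even
    indices from [0] to [m]; the last column is special if [m] is even, and
    [Ai] is then the inverse of [A m]. *)
Definition tridiagonal (T : 'M[R]_(m * n)) (A : nat -> 'M[R]_n) (Ai : 'M[R]_n) :=
  forall j, (j < m)%N -> T *m fc j =
    if odd j then
      x *: fc j.-1 - (if j.+1 == m then fc j *m Ai else fc j.+1)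
    else x *: fc j.+1 + fc j *m (x *: A j.+1 + A j)
         - (if j is j'.+1 then fc j' else 0).

Section Solve.

Variables (T : 'M[R]_(m * n)) (A : nat -> 'M[R]_n) (Ai : 'M[R]_n).
Hypothesis triT : tridiagonal T A Ai.
Hypothesis AiA : ~~ odd m -> Ai *m A m = 1%:M.

Lemma tridiagonal_odd j : (j.*2.+2 < m)%N -> T *m fc j.*2.+1 = x *: fc j.*2 - fc j.*2.+2.
Proof.
move=> lt; rewrite triT ?(ltn_trans _ lt) //= odd_double /=.
by rewrite ltn_eqF.
Qed.

Lemma tridiagonal_even j : (j.*2.+2 < m)%N -> T *m fc j.*2.+2 =
  x *: fc j.*2.+3 + fc j.*2.+2 *m (x *: A j.*2.+3 + A j.*2.+2) - fc j.*2.+1.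
Proof. by move=> lt; rewrite triT //= odd_double. Qed.

Lemma tridiagonal_last j : j.*2.+2 = m ->
  T *m fc j.*2.+1 = x *: fc j.*2 - fc j.*2.+1 *m Ai.
Proof. by move=> E; rewrite triT -?E //= odd_double /= eqxx. Qed.

(** The odd columns of [T] allow one to trade block [2 j + 2] for [x] times
    block [2 j]. *)
Lemma tridiagonal_even_mod j : (j.*2 < m)%N ->
  exists z : 'M_(m * n, n), fr 0 *m z = 0 /\ fc j.*2 = x ^+ j *: fc 0 + T *m z.
Proof.
elim: j => [|j IH] lt; first by exists 0; rewrite expr0 scale1r !mulmx0 addr0.
rewrite doubleS in lt *; have [|z [z0 Ez]] := IH; first by lia.
exists (x *: z - fc j.*2.+1); split.
  by rewrite mulmxBr -scalemxAr z0 scaler0 sub0r brow_bcol0 ?oppr0.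
rewrite mulmxBr -scalemxAr tridiagonal_odd //.
have {}Ez : T *m z = fc j.*2 - x ^+ j *: fc 0 by rewrite Ez addrC addKr.
rewrite Ez; move: (fc _) (fc _) (fc _) => f1 f2 f3.
by apply/matrixP=> a b; rewrite !mxE exprS; ring.
Qed.

(** Adding the even columns one by one produces the partial sums of the
    polynomial, with a remainder at the next odd block. *)
Lemma tridiagonal_partial_solution j : (j.*2 < m)%N ->
  exists z : 'M_(m * n, n), fr 0 *m z = 1%:M /\
    T *m z = fc 0 *m (\sum_(i < j.*2.+2) x ^+ i *: A i) + x ^+ j.+1 *: fc j.*2.+1.
Proof.
elim: j => [|j IH] lt.
  exists (fc 0); split; first exact: brow_bcol_id.
  rewrite triT //= subr0 addrC !big_ord_recr big_ord0 /= add0r expr0 expr1 scale1r.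
  by rewrite [A 0%N + _]addrC.
rewrite doubleS in lt *; have [|z [z1 Tz]] := IH; first by lia.
have [w [w0 Ew]] : exists w : 'M_(m * n, n), fr 0 *m w = 0 /\
    fc j.*2.+2 = x ^+ j.+1 *: fc 0 + T *m w by have := @tridiagonal_even_mod j.+1; rewrite doubleS; apply.
have [B EB] : {B | B = x *: A j.*2.+3 + A j.*2.+2} by exists (x *: A j.*2.+3 + A j.*2.+2).
exists (z + x ^+ j.+1 *: (fc j.*2.+2 - w *m B)); split.
  rewrite mulmxDr z1 -scalemxAr mulmxBr brow_bcol0 // mulmxA w0 mul0mx subrr scaler0.
  by rewrite addr0.
rewrite mulmxDr Tz -scalemxAr mulmxBr tridiagonal_even // -EB.
have -> : T *m (w *m B) = fc j.*2.+2 *m B - x ^+ j.+1 *: (fc 0 *m B).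
  by rewrite {1}Ew mulmxDl -scalemxAl addrAC subrr add0r mulmxA.
have eB : fc 0 *m B = x *: (fc 0 *m A j.*2.+3) + fc 0 *m A j.*2.+2.
  by rewrite EB mulmxDr -scalemxAr.
rewrite 2![in RHS]big_ord_recr /= mulmxDr mulmxDr -!scalemxAr eB.
move: (_ *m \sum_(i < _) _) (fc 0 *m A _) (fc 0 *m A _) (_ *m B).
move: (fc _) (fc _) => f1 f3 S a3 a2 fB.
apply/matrixP=> a b; rewrite !mxE !exprS -addnn exprD; ring.
Qed.

(** If [m] is odd, the last remainder falls off the end; if [m] is even, it sits
    at the last block and the last column turns it into the leading term. *)
Lemma tridiagonal_solution : exists z : 'M_(m * n, n), fr 0 *m z = 1%:M /\
    T *m z = fc 0 *m (\sum_(i < m.+1) x ^+ i *: A i).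
Proof.
have [mo|me] := boolP (odd m).
  have [|z [z1 Tz]] := @tridiagonal_partial_solution m./2; first by lia.
  exists z; split=> //; rewrite Tz.
  have -> : m./2.*2.+1 = m by lia.
  by rewrite (@bcol_out R m n m (leqnn m)) scaler0 addr0.
pose j := m./2.-1; have Em : j.*2.+2 = m by rewrite /j; lia.
have [|z [z1 Tz]] := @tridiagonal_partial_solution j; first by lia.
have [|w [w0 Ew]] := @tridiagonal_even_mod j; first by lia.
have Tl := tridiagonal_last Em.
have Al := AiA me.
(* f_(m-1) = f_(m-1) Ai A_m, and the last column expresses f_(m-1) Ai *)
exists (z - x ^+ j.+1 *: (x *: (w *m A m) - fc j.*2.+1 *m A m)); split.
  rewrite mulmxBr z1 -scalemxAr mulmxBr -scalemxAr !mulmxA w0 brow_bcol0 // !mul0mx.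
  by rewrite scaler0 subrr scaler0 subr0.
rewrite mulmxBr Tz -scalemxAr mulmxBr -scalemxAr !mulmxA Tl mulmxBl -(mulmxA _ Ai) Al mulmx1.
have {}Ew : T *m w = fc j.*2 - x ^+ j *: fc 0 by rewrite Ew addrC addKr.
rewrite Ew mulmxBl -!scalemxAl Em big_ord_recr /= mulmxDr -scalemxAr.
have -> : x ^+ m = x ^+ j * x ^+ j * x * x by rewrite -exprD -!exprSr addnn Em.
move: (_ *m \sum_(i < _) _) (fc 0 *m A m) (fc j.*2 *m A m) (fc j.*2.+1) => S a0 a1 f.
by apply/matrixP=> a b; rewrite !mxE !exprS; ring.
Qed.

Section Unit.

Variable W : 'M[R]_(m * n).
Hypothesis W0 : W *m fc 0 = fc 0.
Hypothesis WT : forall z : 'M_(m * n, n), fr 0 *m z = 0 ->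
  exists w : 'M_n, W *m z = T *m z + fc 0 *m w.

Let in_image (c : 'M[R]_(m * n, n)) := exists z, W *m z = c.

Let in_imageD c d : in_image c -> in_image d -> in_image (c + d).
Proof. by move=> [z <-] [w <-]; exists (z + w); rewrite mulmxDr. Qed.
Let in_imageB c d : in_image c -> in_image d -> in_image (c - d).
Proof. by move=> [z <-] [w <-]; exists (z - w); rewrite mulmxBr. Qed.
Let in_imageZ a c : in_image c -> in_image (a *: c).
Proof. by move=> [z <-]; exists (a *: z); rewrite scalemxAr. Qed.
Let in_imageM c P : in_image c -> in_image (c *m P).
Proof. by move=> [z <-]; exists (z *m P); rewrite mulmxA. Qed.
Let in_image0 P : in_image (fc 0 *m P).
Proof. by exists (fc 0 *m P); rewrite mulmxA W0. Qed.
Let in_imageT j : in_image (T *m fc j.+1).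
Proof.
have [|w E] := WT (z := fc j.+1); first exact: brow_bcol0.
have -> : T *m fc j.+1 = W *m fc j.+1 - fc 0 *m w by rewrite E addrK.
by apply: in_imageB => //; exists (fc j.+1).
Qed.

Let in_image_even j : (j.*2 < m)%N -> in_image (fc j.*2).
Proof.
elim: j => [|j IH] lt; first by exists (fc 0).
rewrite doubleS in lt *.
have -> : fc j.*2.+2 = x *: fc j.*2 - T *m fc j.*2.+1.
  by rewrite tridiagonal_odd // opprB addrC subrK.
by apply: in_imageB => //; apply: in_imageZ; apply: IH; lia.
Qed.

Let in_image_odd k j : (m <= j.*2.+1 + k)%N -> in_image (fc j.*2.+1).
Proof.
elim: k j => [|k IH] j le.
  by rewrite bcol_out; [exists 0; rewrite mulmx0 | lia].
have [gt|lt] := leqP m j.*2.+1; first by rewrite bcol_out //; exists 0; rewrite mulmx0.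
have [Em|ne] := eqVneq j.*2.+2 m.
  have -> : fc j.*2.+1 = (x *: fc j.*2 - T *m fc j.*2.+1) *m A m.
    rewrite (tridiagonal_last Em) opprB addrC subrK -mulmxA AiA ?mulmx1 //; lia.
  by apply: in_imageM; apply: in_imageB => //; apply: in_imageZ; apply: in_image_even; lia.
have lt2 : (j.*2.+2 < m)%N by lia.
have := tridiagonal_even lt2.
set B := _ + A _ => E.
have -> : fc j.*2.+1 = x *: fc j.+1.*2.+1 + fc j.+1.*2 *m B - T *m fc j.*2.+2.
  by rewrite E doubleS opprB addrC subrK.
apply: in_imageB => //; apply: in_imageD; first by apply/in_imageZ/IH; lia.
by apply: in_imageM; apply: in_image_even; lia.
Qed.

(** The image of [W] contains the even block units by going up along the odd
    columns of [T], and then the odd ones by going down along the even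
    columns. *)
Lemma tridiagonal_unit : W \in unitmx.
Proof.
have ImA j : in_image (fc j).
  have [le|lt] := leqP m j; first by rewrite bcol_out //; exists 0; rewrite mulmx0.
  rewrite -(odd_double_half j); case: (odd j); rewrite ?add0n ?add1n.
    by apply: (@in_image_odd m); lia.
  by apply: in_image_even; lia.
have {ImA} H k : exists Z, W *m Z = \sum_(j < k) fc j *m fr j.
  elim: k => [|k [Z E]]; first by exists 0; rewrite big_ord0 mulmx0.
  have [z Ez] := ImA k; exists (Z + z *m fr k).
  by rewrite big_ord_recr /= mulmxDr mulmxA Ez E.
have [Z E] := H m; rewrite sum_bcol_brow in E.
exact: (mulmx1_unit E).1.
Qed.

End Unit.
End Solve.

(** Replacing the last block column of the identity by [z] and its last block
    row by [y] decouples block [0].  The complementary part, completed by an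
    identity block, is invertible by [tridiagonal_unit]. *)
Theorem tridiagonal_linearization T A Ai :
  tridiagonal T A Ai -> tridiagonal T^T (fun i => (A i)^T) Ai^T ->
  (~~ odd m -> Ai *m A m = 1%:M) -> 
  let P := \sum_(i < m.+1) x ^+ i *: A i in
  exists U V : 'M[R]_(m * n),
    [/\ U \in unitmx, V \in unitmx, U *m fc 0 = fc 0, fr 0 *m V = fr 0
      & U *m T *m V = emx m 0 m P].
Proof.
move=> tT tTt AiA P.
have AiAt : ~~ odd m -> Ai^T *m (A m)^T = 1%:M.
  by move=> me; rewrite -trmx_mul (mulmx1C (AiA me)) trmx1.
have [z [z1 Tz]] := tridiagonal_solution tT AiA.
have [yt [y1t Tyt]] := tridiagonal_solution tTt AiAt.
pose y := yt^T.
have y1 : y *m fc 0 = 1%:M by rewrite -[fc 0]tr_brow -trmx_mul y1t trmx1.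
have Ty : y *m T = P *m fr 0.
  apply: trmx_inj; rewrite trmx_mul trmxK Tyt trmx_mul tr_brow; congr (_ *m _).
  by rewrite /P linear_sum; apply: eq_bigr => i _; rewrite linearZ.
have f00 : fr 0 *m fc 0 = 1%:M by apply: brow_bcol_id.
(* the identity with block row 0 replaced by y and block column 0 by z *)
pose U1 := 1%:M + fc 0 *m (y - fr 0).
pose V1 := 1%:M + (z - fc 0) *m fr 0.
have U1c : U1 *m fc 0 = fc 0.
  by rewrite mulmxDl mul1mx -mulmxA mulmxBl y1 f00 subrr mulmx0 addr0.
have V1r : fr 0 *m V1 = fr 0.
  by rewrite mulmxDr mulmx1 mulmxA mulmxBr z1 f00 subrr mul0mx addr0.
have V1c : V1 *m fc 0 = z by rewrite mulmxDl mul1mx -mulmxA f00 mulmx1 addrC subrK.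
have U1r : fr 0 *m U1 = y by rewrite mulmxDr mulmx1 mulmxA f00 mul1mx addrC subrK.
have uU : U1 \in unitmx.
  suff E : U1 *m (1%:M - fc 0 *m (y - fr 0)) = 1%:M by exact: (mulmx1_unit E).1.
  rewrite mulmxBr mulmx1 mulmxA U1c /U1 addrK //.
have uV : V1 \in unitmx.
  suff E : (1%:M - (z - fc 0) *m fr 0) *m V1 = 1%:M by exact: (mulmx1_unit E).2.
  by rewrite mulmxBl mul1mx -mulmxA V1r /V1 addrK.
(* the corner block P of U1 T V1 is replaced by the identity *)
pose W := U1 *m T *m V1 + fc 0 *m (1%:M - P) *m fr 0.
have W0 : W *m fc 0 = fc 0.
  rewrite mulmxDl -!mulmxA V1c f00 mulmx1 Tz mulmxA U1c mulmxBr mulmx1.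
  by rewrite addrC subrK.
have WT (v : 'M_(m * n, n)) : fr 0 *m v = 0 -> exists w : 'M_n, W *m v = T *m v + fc 0 *m w.
  move=> v0; exists ((y - fr 0) *m (T *m v)).
  rewrite {1}/W mulmxDl -!mulmxA v0 !mulmx0 addr0.
  have -> : V1 *m v = v by rewrite mulmxDl mul1mx -mulmxA v0 mulmx0 addr0.
  by rewrite /U1 [LHS]mulmxDl mul1mx !mulmxA.
have uW := tridiagonal_unit tT AiA W0 WT.
have EW : U1 *m T *m V1 = W *m emx m 0 m P.
  have c0 : fc m = 0 by rewrite bcol_out.
  have r0 : fr m = 0 by rewrite brow_out.
  rewrite /emx c0 r0 !mulmx0 !mul0mx !addr0 subr0 mulmxDr mulmx1 !mulmxA W0.
  rewrite {1}/W -addrA -mulmxDl -mulmxDr -opprB addNr mulmx0 mul0mx addr0 //.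
exists (invmx W *m U1), V1; split=> //.
- by rewrite unitmx_mul unitmx_inv uW.
- by rewrite -mulmxA U1c -{1}W0 mulKmx.
- by rewrite -!mulmxA (mulmxA U1) EW mulKmx.
Qed.

End Tridiagonal.

(** * The tridiagonal pencil of a polynomial matrix *)

Section Psi.
Variable m : nat.
Lemma place_w_layout : layout m (place_w m).
Proof. by split=> // -[|i] [|j] /=; lia. Qed.

Lemma place_v_layout : layout m (place_v m).
Proof. by split=> *; rewrite /place_v; lia. Qed.
End Psi.

Section TwoSides.

Variables (F : fieldType) (m n : nat).
Local Notation fc := (bcol F m n).
Local Notation fr := (brow F m n).

(** Place [i] of the negative side touches no block below [m - i - 1], and index
    [j] of the nonnegative side none above [j]. *)
Lemma emx_prod_vw_comm (lv lw : seq (nat * 'M[F]_n)) :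
  (forall i j, i \in unzip1 lv -> j \in unzip1 lw -> i + j + 1 < m)%N ->
  emx_prod m (place_v m) lv *m emx_prod m (place_w m) lw =
  emx_prod m (place_w m) lw *m emx_prod m (place_v m) lv.
Proof.
move=> H; apply: emx_prod_comm => i j iv jw; have := H i j iv jw.
by rewrite /place_v; case: (j) => [|j'] /=; lia.
Qed.

Lemma emx_prod_v_id (lv : seq (nat * 'M[F]_n)) j :
  {in unzip1 lv, forall i, i + j + 1 < m}%N ->
  emx_prod m (place_v m) lv *m fc j = fc j /\ fr j *m emx_prod m (place_v m) lv = fr j.
Proof. by move=> H; apply: emx_prod_id => i /H; rewrite /place_v; lia. Qed.

Lemma emx_prod_w_id (lw : seq (nat * 'M[F]_n)) j : {in unzip1 lw, forall i, i < j}%N ->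
  emx_prod m (place_w m) lw *m fc j = fc j /\ fr j *m emx_prod m (place_w m) lw = fr j.
Proof.
move=> H; have [le|lt] := leqP m j; first by rewrite bcol_out ?brow_out ?mulmx0 ?mul0mx.
by apply: emx_prod_id => i /H; case: i => [|i] /=; lia.
Qed.

Lemma emx_prod_unit psi (l : seq (nat * 'M[F]_n)) : layout m psi ->
  all (fun x => (x.1 < m)%N && ((x.1 == 0%N) ==> (x.2 \in unitmx))) l ->
  emx_prod m psi l \in unitmx.
Proof.
case=> psi0 psil psii; elim: l => [_|[i P] l IH] /=; first by rewrite emx_prod_nil unitmx1.
case/andP=> /andP[lt /implyP u0] /IH ul; rewrite emx_prod_cons unitmx_mul ul andbT /=.
case: i lt u0 => [|i] lt u0; first by rewrite psi0 emx_out_unit ?psil ?u0.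
by apply: emx_unit; rewrite ?psil ?psii ?gtn_eqF //; apply: ltnW.
Qed.

End TwoSides.

Section Linearize.

Variables (F : fieldType) (m n h : nat).
Hypotheses (lt_hm : (h < m)%N) (even_h : ~~ odd h).
Local Notation fc := (bcol F m n).
Local Notation fr := (brow F m n).
Local Notation h' := (m - h - 1)%N.

(** These four products are the ones called [P], [Q], [E], [O] above: a factor
    for each side and each parity of [|i|], recalling that [h] is even and that
    place [j] on the negative side belongs to [|i| = m - j]. *)
Definition w_odd A := @parity_prod F m n (place_w m) h (fun i => - A i).
Definition w_even A := @parity_prod F m n (place_w m) h.+1 (fun i => - A i).
Definition v_even A := @parity_prod F m n (place_v m) h' (fun j => A (m - j)%N).
Definition v_odd A := @parity_prod F m n (place_v m) h'.+1 (fun j => A (m - j)%N).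

Section Actions.
Variable A : nat -> 'M[F]_n.

Lemma le_h1 : (h <= m)%N. Proof. exact: ltnW. Qed.
Lemma le_h' : (h' <= m)%N. Proof. by lia. Qed.
Lemma le_h'1 : (h'.+1 <= m)%N. Proof. by lia. Qed.

Lemma w_odd_bcol j : (j < h)%N -> ~~ odd j ->
  w_odd A *m fc j.+1 = - (fc j.+1 *m A j.+1) + fc j /\ w_odd A *m fc j = fc j.+1.
Proof.
move=> lt ev; have [|||E1 E2] := 
  @parity_prod_bcol F m n (place_w m) (place_w_layout m) h (fun i => - A i) j.+1;
  try (rewrite /=; lia).
by split; [rewrite /w_odd E1 mulmxN | exact: E2].
Qed.

Lemma w_odd_id j : (h <= j)%N -> w_odd A *m fc j = fc j.
Proof.
move=> le; have [lt|ge] := ltnP j m; last by rewrite bcol_out ?mulmx0.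
by have [|] := @parity_prod_id F m n (place_w m) (place_w_layout m) h (fun i => - A i) j.+1; first by lia.
Qed.

Lemma w_even_bcol j : (j <= h)%N -> ~~ odd j ->
  w_even A *m fc j = - (fc j *m A j) + (if j is j'.+1 then fc j' else 0).
Proof.
move=> lt ev; have [|||E1 _] := 
  @parity_prod_bcol F m n (place_w m) (place_w_layout m) h.+1 (fun i => - A i) j;
  try (rewrite /=; lia).
rewrite /w_even E1 mulmxN; congr (_ + _); case: (j) => //=.
by rewrite bcol_out.
Qed.

Lemma w_even_bcol_odd j : (j < h)%N -> odd j -> w_even A *m fc j = fc j.+1.
Proof.
move=> lt ev; have [|||_ E] := 
  @parity_prod_bcol F m n (place_w m) (place_w_layout m) h.+1 (fun i => - A i) j.+1;
  try (rewrite /=; lia).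
exact: E.
Qed.

Lemma w_even_id j : (h < j)%N -> w_even A *m fc j = fc j.
Proof.
move=> le; have [lt|ge] := ltnP j m; last by rewrite bcol_out ?mulmx0.
by have [|] := @parity_prod_id F m n (place_w m) (place_w_layout m) h.+1 (fun i => - A i) j.+1; first by lia.
Qed.

Lemma v_even_bcol k : (h < k)%N -> (k < m)%N -> odd k ->
  v_even A *m fc k = fc k *m A k.+1 + fc k.+1 /\ ((k.+1 < m)%N -> v_even A *m fc k.+1 = fc k).
Proof.
move=> lt ltm ev; have [|||E1 E2] := 
  @parity_prod_bcol F m n (place_v m) (place_v_layout m) h' (fun j => A (m - j)%N) (m - k.+1)%N;
  try lia.
have e1 : place_v m (m - k.+1).+1 = k by rewrite /place_v; lia.
have e2 : place_v m (m - k.+1) = k.+1 by rewrite /place_v; lia.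
have e3 : (m - (m - k.+1) = k.+1)%N by lia.
rewrite e1 e2 e3 in E1 E2; split=> // lt2; apply: E2; lia.
Qed.

Lemma v_even_id j : (j <= h)%N -> v_even A *m fc j = fc j.
Proof.
move=> le.
have [|E _] := @parity_prod_id F m n (place_v m) (place_v_layout m) h' (fun j => A (m - j)%N) (m - j)%N; first by lia.
have e : place_v m (m - j) = j by rewrite /place_v; lia.
by rewrite e in E.
Qed.

Lemma v_odd_bcol k : (h <= k)%N -> (k < m)%N -> ~~ odd k ->
  v_odd A *m fc k = fc k *m A k.+1 + fc k.+1 /\ ((k.+1 < m)%N -> v_odd A *m fc k.+1 = fc k).
Proof.
move=> lt ltm ev; have [|||E1 E2] := 
  @parity_prod_bcol F m n (place_v m) (place_v_layout m) h'.+1 (fun j => A (m - j)%N) (m - k.+1)%N;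
  try (rewrite /=; lia).
have e1 : place_v m (m - k.+1).+1 = k by rewrite /place_v; lia.
have e2 : place_v m (m - k.+1) = k.+1 by rewrite /place_v; lia.
have e3 : (m - (m - k.+1) = k.+1)%N by lia.
rewrite e1 e2 e3 in E1 E2; split=> // lt2; apply: E2; lia.
Qed.

Lemma v_odd_id j : (j < h)%N -> v_odd A *m fc j = fc j.
Proof.
move=> le.
have [|E _] := @parity_prod_id F m n (place_v m) (place_v_layout m) h'.+1 (fun j => A (m - j)%N) (m - j)%N; first by lia.
have e : place_v m (m - j) = j by rewrite /place_v; lia.
by rewrite e in E.
Qed.

Lemma w_odd_unit : w_odd A \in unitmx.
Proof.
apply: (emx_prod_unit (place_w_layout m)); rewrite all_map; apply/allP => i.
by rewrite mem_down2 => /andP[lt par] /=; apply/andP; split; [lia | apply/implyP; lia].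
Qed.

Lemma v_even_unit : (~~ odd m -> A m \in unitmx) -> v_even A \in unitmx.
Proof.
move=> uA; apply: (emx_prod_unit (place_v_layout m)); rewrite all_map; apply/allP => i.
rewrite mem_down2 => /andP[lt par] /=; apply/andP; split; first by lia.
by apply/implyP => /eqP i0; rewrite i0 subn0; apply: uA; lia.
Qed.

Lemma v_even_w_odd_comm : v_even A *m w_odd A = w_odd A *m v_even A.
Proof. by apply: emx_prod_vw_comm => i j; rewrite !unzip1_down2 !mem_down2; lia. Qed.

Lemma v_odd_w_odd_comm : v_odd A *m w_odd A = w_odd A *m v_odd A.
Proof. by apply: emx_prod_vw_comm => i j; rewrite !unzip1_down2 !mem_down2; lia. Qed.

Lemma v_even_w_even_comm : v_even A *m w_even A = w_even A *m v_even A.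
Proof. by apply: emx_prod_vw_comm => i j; rewrite !unzip1_down2 !mem_down2; lia. Qed.

(** The inverse of [M_i (- A_i)] is [M_(-i) (A_i)], so this is the product of
    [M_(-i) (A_i)] over all odd [i] up to [m]; it does not depend on [h]. *)
Definition odd_mx := invmx (w_odd A) *m v_odd A.
Definition even_mx := invmx (v_even A) *m w_even A.

Lemma odd_mx_bcol_even j : (j < m)%N -> ~~ odd j -> odd_mx *m fc j = fc j.+1 + fc j *m A j.+1.
Proof.
move=> lt ev; rewrite /odd_mx -mulmxA; apply: (can_inj (mulKmx w_odd_unit)).
rewrite mulKVmx ?w_odd_unit // mulmxDr mulmxA.
have [lt_jh|le_hj] := ltnP j h.
  have [E1 E2] := w_odd_bcol lt_jh ev.
  by rewrite v_odd_id // E1 E2 addrAC addNr add0r.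
by rewrite (proj1 (v_odd_bcol le_hj lt ev)) !w_odd_id //; [rewrite addrC | lia].
Qed.

Lemma odd_mx_bcol_odd j : (j < m)%N -> odd j -> odd_mx *m fc j = fc j.-1.
Proof.
move=> lt od; rewrite /odd_mx -mulmxA; apply: (can_inj (mulKmx w_odd_unit)).
rewrite mulKVmx ?w_odd_unit //; case: j lt od => //= j lt od.
have [lt_jh|le_hj] := ltnP j.+1 h.
  by rewrite v_odd_id // (proj2 (w_odd_bcol _ _)) //; lia.
have le : (h <= j)%N by lia.
by rewrite (proj2 (v_odd_bcol le (ltnW lt) od)) // w_odd_id.
Qed.

Hypothesis uA : ~~ odd m -> A m \in unitmx.

Lemma even_mx_bcol_even j : (j < m)%N -> ~~ odd j ->
  even_mx *m fc j = - (fc j *m A j) + (if j is j'.+1 then fc j' else 0).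
Proof.
move=> lt ev; have uE := v_even_unit uA.
rewrite /even_mx -mulmxA; apply: (can_inj (mulKmx uE)).
rewrite mulKVmx // mulmxDr mulmxN mulmxA.
have [le_jh|lt_hj] := leqP j h.
  rewrite w_even_bcol // v_even_id //; congr (_ + _).
  by case: (j) le_jh => [|j'] le; rewrite ?mulmx0 // v_even_id // ltnW.
rewrite w_even_id //; case: j lt ev lt_hj => //= j lt ev lt_hj.
have [|||E1 E2] := @v_even_bcol j; try lia.
by rewrite E1 ?E2 // ?addKr //; lia.
Qed.

Lemma even_mx_bcol_odd j : (j < m)%N -> odd j ->
  even_mx *m fc j = if j.+1 == m then fc j *m invmx (A m) else fc j.+1.
Proof.
move=> lt od; have uE := v_even_unit uA.
rewrite /even_mx -mulmxA; apply: (can_inj (mulKmx uE)).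
rewrite mulKVmx //; have [le_jh|lt_hj] := leqP j h.
  have lt_jh : (j < h)%N by lia.
  by rewrite w_even_bcol_odd // ltn_eqF ?v_even_id //; lia.
rewrite w_even_id //; have [E1 E2] := v_even_bcol lt_hj lt od.
have [Em|ne] := eqVneq j.+1 m; last by rewrite E2 //; lia.
rewrite mulmxA E1 Em (@bcol_out F m n m (leqnn m)) addr0 -mulmxA mulmxV ?mulmx1 //.
by apply: uA; lia.
Qed.

Definition tri_pencil := 'X *: mxC odd_mx - mxC even_mx.

Lemma mxC_bcol j : mxC (fc j) = bcol {poly F} m n j.
Proof. by apply/matrixP=> a b; rewrite !mxE rmorph_nat. Qed.

Lemma tri_pencil_tridiagonal : tridiagonal 'X tri_pencil (fun i => mxC (A i)) (mxC (invmx (A m))).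
Proof.
move=> j lt; rewrite /tri_pencil mulmxBl -scalemxAl -!mxC_bcol -!map_mxM.
have [od|ev] := ifPn.
  rewrite odd_mx_bcol_odd // even_mx_bcol_odd //.
  by case: ifP => _; rewrite ?map_mxM.
rewrite odd_mx_bcol_even // even_mx_bcol_even //.
rewrite !map_mxD map_mxN !map_mxM scalerDr mulmxDr -scalemxAr.
rewrite opprD opprK addrA -!addrA; congr (_ + (_ + (_ - _))).
by case: (j) => [|j']; rewrite ?map_mx0 ?mxC_bcol.
Qed.

End Actions.

Lemma tr_w_odd A : (w_odd A)^T = w_odd (fun i => (A i)^T).
Proof.
rewrite /w_odd (tr_parity_prod (place_w_layout m)) ?le_h1 //; congr emx_prod; apply: eq_map => i.
by congr (_, _); rewrite linearN.
Qed.
Lemma tr_w_even A : (w_even A)^T = w_even (fun i => (A i)^T).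
Proof.
rewrite /w_even (tr_parity_prod (place_w_layout m)) //; congr emx_prod; apply: eq_map => i.
by congr (_, _); rewrite linearN.
Qed.
Lemma tr_v_even A : (v_even A)^T = v_even (fun i => (A i)^T).
Proof. by rewrite /v_even (tr_parity_prod (place_v_layout m)) ?le_h'. Qed.
Lemma tr_v_odd A : (v_odd A)^T = v_odd (fun i => (A i)^T).
Proof. by rewrite /v_odd (tr_parity_prod (place_v_layout m)) ?le_h'1. Qed.

Lemma mulmx_invmx_comm N (M K : 'M[F]_N) : M \in unitmx -> K *m M = M *m K ->
  K *m invmx M = invmx M *m K.
Proof.
by move=> uM E; rewrite -[K in LHS](mulKmx uM) -E -mulmxA mulmxK.
Qed.

Lemma tr_tri_pencil A : (~~ odd m -> A m \in unitmx) -> (tri_pencil A)^T = tri_pencil (fun i => (A i)^T).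
Proof.
move=> uA; rewrite /tri_pencil linearB /= linearZ /= !matrix.map_trmx /odd_mx /even_mx !trmx_mul.
rewrite !trmx_inv tr_w_odd tr_w_even tr_v_even tr_v_odd.
rewrite mulmx_invmx_comm ?w_odd_unit ?v_odd_w_odd_comm //.
rewrite [w_even _ *m _]mulmx_invmx_comm ?v_even_w_even_comm //.
by apply: v_even_unit => me; rewrite unitmx_tr uA.
Qed.

(** The left solution comes from the right solution for the transposed
    coefficients, as [tr_tri_pencil] makes the construction symmetric. *)
Lemma tri_pencil_linearization A : (~~ odd m -> A m \in unitmx) ->
  exists U V : 'M[{poly F}]_(m * n),
    [/\ U \in unitmx, V \in unitmx, U *m bcol _ m n 0 = bcol _ m n 0,
        brow _ m n 0 *m V = brow _ m n 0
      & U *m tri_pencil A *m V = emx m 0 m (mx_poly m A)].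
Proof.
move=> uA; apply: (tridiagonal_linearization _ (tri_pencil_tridiagonal uA)); first by lia.
  rewrite tr_tri_pencil // matrix.map_trmx trmx_inv.
  have uAt : ~~ odd m -> (A m)^T \in unitmx by move=> /uA; rewrite unitmx_tr.
  have := @tri_pencil_tridiagonal (fun i => (A i)^T) uAt.
  by move=> H j /H ->; rewrite !matrix.map_trmx.
move=> me; rewrite -map_mxM mulVmx ?map_mx1 //; exact: uA.
Qed.

End Linearize.

(** * From tuples of integers to products *)

Section Translate.

Variables (F : fieldType) (m n : nat).
Implicit Types (psi : nat -> nat) (f : nat -> int) (X : seq 'M[F]_n) (A : nat -> 'M[F]_n).

Definition realizes f psi := forall i (P : 'M[F]_n), (i < m)%N ->
  elem_mx m (f i) P = emx m (psi i.+1) (psi i) P.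

Lemma elem_prod_cat (s t : seq int) (X Y : seq 'M[F]_n) : size X = size s ->
  elem_prod m (s ++ t) (X ++ Y) = elem_prod m s X *m elem_prod m t Y.
Proof.
move=> sz; rewrite /elem_prod zip_cat //.
by elim: (zip s X) => [|x l IH]; rewrite ?big_nil ?mul1mx //= !big_cons IH mulmxA.
Qed.

Lemma elem_prod_map f psi t X : realizes f psi -> all (fun i => i < m)%N t ->
  elem_prod m (map f t) X = emx_prod m psi (zip t X).
Proof.
move=> fpsi; rewrite /elem_prod /emx_prod.
elim: t X => [|i t IH] [|P X] //=; rewrite ?big_nil // => /andP[lt al].
by rewrite !big_cons IH //= fpsi.
Qed.

Definition signed_coef (A : nat -> 'M[F]_n) f (i : nat) : 'M[F]_n :=
  if 0 <= f i then - A `|f i|%N else A `|f i|%N.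

Lemma elem_prodA_map A f psi t : realizes f psi -> all (fun i => i < m)%N t ->
  elem_prodA m A (map f t) = emx_prod m psi [seq (i, signed_coef A f i) | i <- t].
Proof.
move=> fpsi al; rewrite /elem_prodA (elem_prod_map _ fpsi al); congr emx_prod.
by rewrite /trivial_assignment -map_comp; elim: (t) => //= i u ->.
Qed.

Lemma elem_prodA_cat (A : nat -> 'M[F]_n) s t :
  elem_prodA m A (s ++ t) = elem_prodA m A s *m elem_prodA m A t.
Proof. by rewrite /elem_prodA /trivial_assignment map_cat elem_prod_cat ?size_map. Qed.

(** Only entries that occur in the tuple need to commute, as elementary matrices
    are meaningful for indices in range only. *)
Lemma tuple_equiv_prod (G : int -> 'M[F]_(m * n)) s t : tuple_equiv s t ->
  (forall a b, a \in s -> b \in s -> 1 < `|a - b| -> G a *m G b = G b *m G a) ->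
  \big[mulmx/1%:M]_(i <- s) G i = \big[mulmx/1%:M]_(i <- t) G i.
Proof.
move=> te comm; elim: te => // t' u a b lt te ->; have p := tuple_equiv_perm te.
have cat_ (v w : seq int) : \big[mulmx/1%:M]_(i <- v ++ w) G i =
    (\big[mulmx/1%:M]_(i <- v) G i) *m (\big[mulmx/1%:M]_(i <- w) G i).
  by elim: v => [|x v IH]; rewrite ?big_nil ?mul1mx //= !big_cons IH mulmxA.
rewrite !cat_ !big_cons !mulmxA; congr (_ *m _); rewrite -!mulmxA; congr (_ *m _).
by apply: comm => //; rewrite (perm_mem p) mem_cat !inE eqxx ?orbT.
Qed.

Lemma elem_prodA_big (A : nat -> 'M[F]_n) s : elem_prodA m A s =
  \big[mulmx/1%:M]_(i <- s) elem_mx m i (if 0 <= i then - A `|i|%N else A `|i|%N).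
Proof.
rewrite /elem_prodA /elem_prod /trivial_assignment.
by elim: s => [|i s IH] /=; rewrite ?big_nil // !big_cons IH.
Qed.

Lemma elem_prodA_parity A f psi p w : realizes f psi -> layout m psi -> (p < m)%N ->
  (forall i j, f i - f j = i%:Z - j%:Z) ->
  tuple_equiv w (map f (down2 p ++ down2 p.+1)) ->
  elem_prodA m A w = parity_prod m psi p (signed_coef A f) *m parity_prod m psi p.+1 (signed_coef A f).
Proof.
move=> fpsi lay lt_pm fB te.
have al q : (q <= m)%N -> all (fun i => i < m)%N (down2 q).
  by move=> le; apply/allP => i; rewrite mem_down2; lia.
rewrite elem_prodA_big (tuple_equiv_prod te) -?elem_prodA_big.
  by rewrite map_cat elem_prodA_cat !(elem_prodA_map _ fpsi) ?al // ltnW.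
move=> a b; rewrite !(perm_mem (tuple_equiv_perm te)) => /mapP[i ip ->] /mapP[j jp ->].
move: ip jp; rewrite !(perm_mem (perm_down2 p)) !mem_iota fB => lti ltj lt1.
rewrite !fpsi; try lia.
have [_ _ inj] := lay.
by apply: emx_comm; rewrite inj; lia.
Qed.

Definition vindex (j : nat) : int := j%:Z - m%:Z.

Lemma realizes_w : realizes Posz (place_w m).
Proof. by move=> i P; apply: elem_mx_w. Qed.
Lemma realizes_v : realizes vindex (place_v m).
Proof. by move=> i P; apply: elem_mx_v. Qed.

Lemma signed_coef_v A i : (i < m)%N -> signed_coef A vindex i = A (m - i)%N.
Proof.
rewrite /signed_coef /vindex => lt; have -> : (0 <= i%:Z - m%:Z) = false by lia.
by congr A; lia.
Qed.

Lemma eq_parity_prod psi q (X Y : nat -> 'M[F]_n) : (forall i, (i < q)%N -> X i = Y i) ->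
  parity_prod m psi q X = parity_prod m psi q Y.
Proof.
move=> E; rewrite /parity_prod; congr emx_prod; apply/eq_in_map => i.
by rewrite mem_down2 => /andP[lt _]; rewrite E.
Qed.

End Translate.

Lemma tuple_equiv_tshift j s t : tuple_equiv s t -> tuple_equiv (tshift j s) (tshift j t).
Proof.
elim=> [|t' u a b lt _ IH]; first exact: tuple_equiv_refl.
rewrite /tshift map_cat /=; apply: tuple_equiv_swap.
  by have -> : a + j - (b + j) = a - b by lia.
by move: IH; rewrite /tshift map_cat.
Qed.

Lemma i0_steps_le s t b : (s <= b)%N -> all (fun i => i <= b)%N t -> (foldr i0_step s t <= b)%N.
Proof.
by move=> le; elim: t => //= i t IH /andP[ib /IH leb]; rewrite /i0_step; case: eqP => // <-.
Qed.

(** Index [i] sends [f_(i-1)] to [f_i] and fixes all block units except [f_i],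
    to which it is never applied by [adj_SIP_cons_neq]. *)
Lemma emx_prod_w_i0 (R : comUnitRingType) m n (l : seq (nat * 'M[R]_n)) g s :
  adj_SIP (unzip1 l ++ g) -> is_i0 g s -> all (fun i => i < m)%N (unzip1 l) -> (s < m)%N ->
  emx_prod m (place_w m) l *m bcol R m n s = bcol R m n (foldr i0_step s (unzip1 l)).
Proof.
move=> + Ig + lts; elim: l => [|[i P] l IH] /=; first by rewrite emx_prod_nil mul1mx.
move=> sip /andP[lti al].
have sip' : adj_SIP (unzip1 l ++ g) by move=> j; have := sorted_adj_drop 1 (sip j); rewrite /= drop0.
rewrite emx_prod_cons -mulmxA IH //=.
have := is_i0_cat (unzip1 l) Ig; set s' := foldr _ _ _ => Is.
have ne := adj_SIP_cons_neq (sip i) Is.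
have lts' : (s' < m)%N.
  rewrite -ltnS; case: m lts lti al {IH} => // m' lts lti al.
  by apply: i0_steps_le.
rewrite /i0_step; case: eqVneq => [E|nE].
  by rewrite E /= emx_bcol_snd // gtn_eqF.
apply: emx_bcol_id => //; case: i nE {ne lti sip} => [|i] /=; first by rewrite gtn_eqF.
by rewrite eqSS.
Qed.

Record side_data (p : nat) (f : nat -> int) (w c t : seq int) (w' t' : seq nat) : Prop := SideData {
  sd_w : w = map f w';
  sd_c : c = map f (down2 p);
  sd_t : t = map f t';
  sd_perm : perm_eq w' (iota 0 p.+1);
  sd_te : tuple_equiv w (map f (down2 p ++ down2 p.+1));
  sd_fil : forall i, adj i w' = adj i (down2 p ++ down2 p.+1);
  sd_canon : canonical_nat p t'
}.

Lemma side_data_w p (w0 c0 t0 : seq int) :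
  simple_admissible p w0 -> symmetric_complement p w0 c0 -> in_canonical_form p t0 ->
  exists w' t', side_data p Posz w0 c0 t0 w' t'.
Proof.
move=> sa sc cf; have [w' [t' [Ew Ec Et [pw te ct]]]] := admissible_data sa sc cf.
exists w', t'; split=> // i; apply: map_Posz_inj; rewrite !adj_int -Ew.
by apply: tuple_equiv_filter te; lia.
Qed.

Lemma side_data_v (m p : nat) (w0 c0 t0 : seq int) :
  simple_admissible p (tshift m w0) -> symmetric_complement p (tshift m w0) (tshift m c0) ->
  in_canonical_form p (tshift m t0) ->
  exists w' t', side_data p (vindex m) w0 c0 t0 w' t'.
Proof.
move=> sa sc cf; have [w' [t' [Ew Ec Et pw te fw ct]]] := side_data_w sa sc cf.
have back s u : tshift m s = map Posz u -> s = map (vindex m) u.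
  move=> E; have -> : map (vindex m) u = tshift (- m%:Z) (map Posz u).
    by rewrite /tshift -map_comp.
  rewrite -E /tshift -map_comp -[LHS]map_id; apply: eq_map => i /=.
  by rewrite addrK.
exists w', t'; split; rewrite ?(back _ _ Ew) ?(back _ _ Ec) ?(back _ _ Et) //.
rewrite -(back _ _ Ew); have := tuple_equiv_tshift (- m%:Z) te.
have -> : tshift (- m%:Z) (tshift m w0) = w0.
  by rewrite /tshift -map_comp -[RHS]map_id; apply: eq_map => i /=; rewrite addrK.
by rewrite /tshift -map_comp.
Qed.

(** Place [0] carries the special index [0] or [-m], the only one for which an
    elementary matrix may be singular. *)
Lemma nonsingular_all (F : fieldType) m n f t' t (Z : seq 'M[F]_n) :
  t = map f t' -> nonsingular_assignment m t Z ->
  (f 0%N == 0) || (f 0%N == - m%:Z) -> all (fun i => i < m)%N t' ->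
  all (fun x => (x.1 < m)%N && ((x.1 == 0%N) ==> (x.2 \in unitmx))) (zip t' Z).
Proof.
move=> Et [sz ns] f0 al; subst t; rewrite /assignment size_map in sz.
elim: t' Z sz ns al => [|i t' IH] [|P Z] //= [sz] ns /andP[lti al].
rewrite lti /= IH // ?andbT.
  by apply/implyP => /eqP i0; subst i; apply: (ns 0%N).
by move=> j lt; apply: (ns j.+1).
Qed.

(** * The nested pencil *)

Lemma unzip1_cat (T1 T2 : Type) (u v : seq (T1 * T2)) :
  unzip1 (u ++ v) = unzip1 u ++ unzip1 v.
Proof. exact: map_cat. Qed.
Lemma unzip1_rev (T1 T2 : Type) (u : seq (T1 * T2)) : unzip1 (rev u) = rev (unzip1 u).
Proof. exact: map_rev. Qed.

Lemma mxC_brow (F : fieldType) m n j : mxC (brow F m n j) = brow {poly F} m n j.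
Proof. by rewrite /brow -mxC_bcol matrix.map_trmx. Qed.

Lemma block_sym_pencil (R : comUnitRingType) m n (x : R) (M1 M0 : 'M[R]_(m * n)) :
  block_sym M1 -> block_sym M0 -> block_sym (x *: M1 - M0).
Proof.
move=> s1 s0 a b; rewrite !mulmxBr !mulmxBl -!scalemxAr -!scalemxAl.
by rewrite (s1 a b) (s0 a b).
Qed.

Section Core.

Variables (F : fieldType) (m n h : nat).
Local Notation fc := (bcol F m n).
Local Notation fr := (brow F m n).
Hypotheses (lt_hm : (h < m)%N) (even_h : ~~ odd h).
Local Notation h' := (m - h - 1)%N.
Local Notation pairs := (seq (nat * 'M[F]_n)).

Section Fixed.
Variable (A : nat -> 'M[F]_n) (lw lv : pairs).
Hypotheses (ct_w : canonical_nat h (unzip1 lw)) (ct_v : canonical_nat h' (unzip1 lv)).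
Local Notation Mw := (emx_prod m (place_w m) lw).
Local Notation Mw' := (emx_prod m (place_w m) (rev lw)).
Local Notation Mv := (emx_prod m (place_v m) lv).
Local Notation Mv' := (emx_prod m (place_v m) (rev lv)).
Local Notation P := (w_odd m h A).
Local Notation Q := (w_even m h A).
Local Notation E := (v_even m h A).
Local Notation O := (v_odd m h A).

Let lw_lt i : i \in unzip1 lw -> (i.+1 < h)%N.
Proof. exact: (allP (canonical_nat_lt ct_w)). Qed.
Let lv_lt i : i \in unzip1 lv -> (i.+1 < h')%N.
Proof. exact: (allP (canonical_nat_lt ct_v)). Qed.

Let swapR (M N Z : 'M[F]_(m * n)) : M *m N = N *m M -> M *m (N *m Z) = N *m (M *m Z).
Proof. by move=> c; rewrite !mulmxA c. Qed.

Let mwE : E *m Mw = Mw *m E.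
Proof. by apply: emx_prod_vw_comm => i j; rewrite unzip1_down2 mem_down2 => ? /lw_lt; lia. Qed.
Let mwO : O *m Mw = Mw *m O.
Proof. by apply: emx_prod_vw_comm => i j; rewrite unzip1_down2 mem_down2 => ? /lw_lt; lia. Qed.
Let mw'E : E *m Mw' = Mw' *m E.
Proof. by apply: emx_prod_vw_comm => i j; rewrite unzip1_down2 mem_down2 unzip1_rev mem_rev => ? /lw_lt; lia. Qed.
Let mwmv' : Mv' *m Mw = Mw *m Mv'.
Proof. by apply: emx_prod_vw_comm => i j; rewrite unzip1_rev mem_rev => /lv_lt ? /lw_lt; lia. Qed.
Let mw'mv' : Mv' *m Mw' = Mw' *m Mv'.
Proof. by apply: emx_prod_vw_comm => i j; rewrite !unzip1_rev !mem_rev => /lv_lt ? /lw_lt; lia. Qed.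
Let mv'P : Mv' *m P = P *m Mv'.
Proof. by apply: emx_prod_vw_comm => i j; rewrite unzip1_rev mem_rev unzip1_down2 mem_down2 => /lv_lt ?; lia. Qed.
Let mv'Q : Mv' *m Q = Q *m Mv'.
Proof. by apply: emx_prod_vw_comm => i j; rewrite unzip1_rev mem_rev unzip1_down2 mem_down2 => /lv_lt ?; lia. Qed.
Let cEP := v_even_w_odd_comm lt_hm even_h A.
Let cEQ := v_even_w_even_comm lt_hm even_h A.

Definition pencil_coef1 := Mv *m Mw *m (E *m O) *m (P *m E) *m (Mw' *m Mv').
Definition pencil_coef0 := Mv *m Mw *m (P *m Q) *m (P *m E) *m (Mw' *m Mv').

(** The complement of the negative side is moved to the left past the
    nonnegative side, which it does not touch. *)
Lemma pencil_coef1E : pencil_coef1 = (Mv *m (E *m O *m E) *m Mv') *m (Mw *m P *m Mw').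
Proof.
rewrite /pencil_coef1 -!mulmxA -mw'mv' -(swapR _ cEP).
rewrite -(swapR _ mwE) -(swapR _ mwO) -(swapR _ mwE).
by rewrite -(swapR _ mv'P) -(swapR _ mwmv').
Qed.

Lemma pencil_coef0E : pencil_coef0 = (Mv *m E *m Mv') *m (Mw *m (P *m Q *m P) *m Mw').
Proof.
rewrite /pencil_coef0 -!mulmxA -mw'mv' -(swapR _ cEP) -(swapR _ cEQ) -(swapR _ cEP).
rewrite -(swapR _ mwE).
by rewrite -(swapR _ mv'P) -(swapR _ mv'Q) -(swapR _ mv'P) -(swapR _ mwmv').
Qed.

(** The first factor fixes the blocks below [b], the second one all others. *)
Lemma block_sym_prod_vw b (gl hl : pairs) : (b <= m)%N ->
  (forall i, i \in unzip1 gl -> i + b < m)%N ->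
  (forall i, i \in unzip1 hl -> i < b)%N ->
  block_sym (emx_prod m (place_v m) gl) -> block_sym (emx_prod m (place_w m) hl) ->
  block_sym (emx_prod m (place_v m) gl *m emx_prod m (place_w m) hl).
Proof.
move=> le Hg Hh sg sh; apply: block_sym_mul => //.
  by apply: emx_prod_vw_comm => i j /Hg ? /Hh ?; lia.
move=> c; have [lt|ge] := ltnP c b; [left|right].
  by apply: emx_prod_v_id => i /Hg; lia.
by apply: emx_prod_w_id => i /Hh; lia.
Qed.

Lemma block_sym_pencil_coef1 : block_sym pencil_coef1.
Proof.
rewrite pencil_coef1E.
pose dl q (X : nat -> 'M[F]_n) : pairs := [seq (i, X i) | i <- down2 q].
pose gl := lv ++ dl h' (fun j => A (m - j)%N) ++ dl h'.+1 (fun j => A (m - j)%N)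
   ++ dl h' (fun j => A (m - j)%N) ++ rev lv.
pose hl := lw ++ dl h (fun i => - A i) ++ rev lw.
have Eg : Mv *m (E *m O *m E) *m Mv' = emx_prod m (place_v m) gl.
  by rewrite /gl !emx_prod_cat !mulmxA.
have Eh : Mw *m P *m Mw' = emx_prod m (place_w m) hl by rewrite /hl !emx_prod_cat !mulmxA.
rewrite Eg Eh; apply: (@block_sym_prod_vw h); first exact: ltnW.
- move=> i; rewrite /gl /dl !unzip1_cat !unzip1_down2 unzip1_rev !mem_cat mem_rev !mem_down2.
  by have := @lv_lt i; case: (i \in _) => H; lia.
- move=> i; rewrite /hl /dl !unzip1_cat !unzip1_down2 unzip1_rev !mem_cat mem_rev !mem_down2.
  by have := @lw_lt i; case: (i \in _) => H; lia.
- rewrite -Eg.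
  by have [|b1 b2] := block_sym_nest (place_v_layout m) (fun j => A (m - j)%N) _ ct_v; first by lia.
rewrite -Eh; by have [|b1 b2] := block_sym_nest (place_w_layout m) (fun i => - A i) _ ct_w; first by lia.
Qed.

Lemma block_sym_pencil_coef0 : block_sym pencil_coef0.
Proof.
rewrite pencil_coef0E.
pose dl q (X : nat -> 'M[F]_n) : pairs := [seq (i, X i) | i <- down2 q].
pose gl := lv ++ dl h' (fun j => A (m - j)%N) ++ rev lv.
pose hl := lw ++ dl h (fun i => - A i) ++ dl h.+1 (fun i => - A i)
   ++ dl h (fun i => - A i) ++ rev lw.
have Eg : Mv *m E *m Mv' = emx_prod m (place_v m) gl by rewrite /gl !emx_prod_cat !mulmxA.
have Eh : Mw *m (P *m Q *m P) *m Mw' = emx_prod m (place_w m) hl by rewrite /hl !emx_prod_cat !mulmxA.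
rewrite Eg Eh; apply: (@block_sym_prod_vw h.+1); first by [].
- move=> i; rewrite /gl /dl !unzip1_cat !unzip1_down2 unzip1_rev !mem_cat mem_rev !mem_down2.
  by have := @lv_lt i; case: (i \in _) => H; lia.
- move=> i; rewrite /hl /dl !unzip1_cat !unzip1_down2 unzip1_rev !mem_cat mem_rev !mem_down2.
  by have := @lw_lt i; case: (i \in _) => H; lia.
- rewrite -Eg.
  by have [|b1 b2] := block_sym_nest (place_v_layout m) (fun j => A (m - j)%N) _ ct_v; first by lia.
rewrite -Eh; by have [|b1 b2] := block_sym_nest (place_w_layout m) (fun i => - A i) _ ct_w; first by lia.
Qed.

Definition nested_pencil : 'M[{poly F}]_(m * n) := 'X *: mxC pencil_coef1 - mxC pencil_coef0.

Lemma block_sym_mxC (M : 'M[F]_(m * n)) : block_sym M -> block_sym (mxC M).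
Proof.
move=> sM a b; by rewrite -!mxC_brow -!mxC_bcol -!map_mxM sM.
Qed.

Lemma blktr_nested_pencil : blktr nested_pencil = nested_pencil.
Proof.
apply/block_sym_blktr/block_sym_pencil; apply: block_sym_mxC;
  [exact: block_sym_pencil_coef1 | exact: block_sym_pencil_coef0].
Qed.

(** Together with [right_factor], the constant matrices around the tridiagonal
    pencil. *)
Definition left_factor := Mv *m Mw *m (P *m E).
Definition right_factor := P *m E *m (Mw' *m Mv').

Lemma nested_pencilE : (~~ odd m -> A m \in unitmx) ->
  nested_pencil = mxC left_factor *m tri_pencil m h A *m mxC right_factor.
Proof.
move=> uA; rewrite /nested_pencil /tri_pencil mulmxBr mulmxBl -scalemxAr -scalemxAl -!map_mxM.
congr (_ *: mxC _ - mxC _).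
  rewrite /pencil_coef1 /left_factor /right_factor /odd_mx -!mulmxA; congr (_ *m (_ *m _)).
  by rewrite -!(swapR _ cEP) mulKVmx ?w_odd_unit.
rewrite /pencil_coef0 /left_factor /right_factor /even_mx -!mulmxA; congr (_ *m (_ *m (_ *m _))).
by rewrite mulKVmx ?v_even_unit.
Qed.

End Fixed.

(** Within the nonnegative side [f_0] moves first to [f_1] if [h > 0], matching
    the inversion [(1, 0)] of [w], and then as prescribed by [tw]. *)
Lemma left_factor_bcol A lw lv (w' : seq nat) :
  canonical_nat h (unzip1 lw) -> canonical_nat h' (unzip1 lv) ->
  (forall i, adj i w' = adj i (down2 h ++ down2 h.+1)) ->
  left_factor A lw lv *m fc 0 = fc (foldr i0_step (1 < h)%N (unzip1 lw)).
Proof.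
move=> ct_w ct_v fw; rewrite /left_factor -!mulmxA v_even_id //.
have -> : w_odd m h A *m fc 0 = fc (1 < h)%N.
  case: ltnP => lt; first by have [] := w_odd_bcol lt_hm even_h A (ltnW lt) isT.
  by apply: w_odd_id => //; lia.
have lw_lt := canonical_nat_lt ct_w.
have sip := adj_SIP_palindrome fw ct_w.
rewrite (@emx_prod_w_i0 _ _ _ _ w'); first last.
- by case: ltnP => //; lia.
- by apply: sub_all lw_lt => i; lia.
- exact: is_i0_parity.
- move=> i; have := sip i; rewrite catA adj_cat.
  by case/cat_sorted2.
apply: (proj1 (emx_prod_v_id _)) => i /(allP (canonical_nat_lt ct_v)) lti.
have : (foldr i0_step (1 < h) (unzip1 lw) <= h)%N.
  apply: i0_steps_le; first by case: ltnP; lia.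
  by apply: sub_all lw_lt => j; lia.
by move: (foldr _ _ _) lti => s /= lti le; lia.
Qed.

(** The transpose of a right factor is a left factor for the transposed
    coefficients. *)
Lemma brow_right_factor A lw lv (w' : seq nat) :
  canonical_nat h (unzip1 lw) -> canonical_nat h' (unzip1 lv) ->
  (forall i, adj i w' = adj i (down2 h ++ down2 h.+1)) ->
  fr 0 *m right_factor A lw lv = fr (foldr i0_step (1 < h)%N (unzip1 lw)).
Proof.
move=> ct_w ct_v fw; apply: trmx_inj; rewrite trmx_mul !tr_brow.
have -> : (right_factor A lw lv)^T = left_factor (fun i => (A i)^T) (tr_pairs lw) (tr_pairs lv).
  rewrite /right_factor /left_factor !trmx_mul tr_w_odd // tr_v_even //.
  rewrite v_even_w_odd_comm // !tr_emx_prod.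
  by rewrite /tr_pairs !map_rev !revK.
by rewrite (@left_factor_bcol _ _ _ w') ?unzip1_tr_pairs.
Qed.

Lemma nested_pencil_linearization A lw lv (w' : seq nat) :
  canonical_nat h (unzip1 lw) -> canonical_nat h' (unzip1 lv) ->
  (forall i, adj i w' = adj i (down2 h ++ down2 h.+1)) ->
  emx_prod m (place_w m) lw \in unitmx -> emx_prod m (place_v m) lv \in unitmx ->
  emx_prod m (place_w m) (rev lw) \in unitmx -> emx_prod m (place_v m) (rev lv) \in unitmx ->
  (~~ odd m -> A m \in unitmx) ->
  let s := foldr i0_step (1 < h)%N (unzip1 lw) in
  exists U V : 'M[{poly F}]_(m * n),
    [/\ U \in unitmx, V \in unitmx, U *m bcol _ m n s = bcol _ m n 0,
        brow _ m n s *m V = brow _ m n 0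
      & U *m nested_pencil A lw lv *m V = emx m 0 m (mx_poly m A)].
Proof.
move=> ct_w ct_v fw uw uv uw' uv' uA s.
have [U [V [uU uV U0 V0 UTV]]] := tri_pencil_linearization lt_hm even_h uA.
have uP := w_odd_unit lt_hm even_h A; have uE := v_even_unit lt_hm even_h uA.
have uL : left_factor A lw lv \in unitmx by rewrite /left_factor !unitmx_mul uv uw uP uE.
have uR : right_factor A lw lv \in unitmx by rewrite /right_factor !unitmx_mul uv' uw' uP uE.
have cu (M : 'M[F]_(m * n)) : M \in unitmx -> mxC M \in unitmx.
  move=> uM; have E : mxC M *m mxC (invmx M) = 1%:M by rewrite -map_mxM mulmxV // map_mx1.
  exact: (mulmx1_unit E).1.
have := brow_right_factor A ct_w ct_v fw; have := left_factor_bcol A ct_w ct_v fw.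
move: (nested_pencilE lw lv uA) uL uR.
move: (nested_pencil _ _ _) (left_factor _ _ _) (right_factor _ _ _) => L K N -> uK uN Kc Nr.
exists (U *m invmx (mxC K)), (invmx (mxC N) *m V); split.
- by rewrite unitmx_mul uU unitmx_inv cu.
- by rewrite unitmx_mul uV unitmx_inv cu.
- by rewrite -mulmxA -mxC_bcol -Kc map_mxM mulKmx ?cu // mxC_bcol U0.
- by rewrite mulmxA -mxC_brow -Nr map_mxM mulmxK ?cu // mxC_brow V0.
rewrite -UTV -!mulmxA; congr (_ *m _).
by rewrite mulKmx ?cu // mulKVmx ?cu.
Qed.

End Core.

(** * One diagonal block *)

Lemma pencil_expand (F : fieldType) N (K M1 M0 K1 K2 : 'M[F]_N) :
  mxC K *m pencil M1 M0 *m mxC K1 *m mxC K2 =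
  'X *: mxC (K *m M1 *m K1 *m K2) - mxC (K *m M0 *m K1 *m K2).
Proof.
by rewrite /pencil mulmxBr !mulmxBl -scalemxAr -!scalemxAl -!map_mxM.
Qed.

Lemma SIP_palindrome p w' t' : (forall i, adj i w' = adj i (down2 p ++ down2 p.+1)) ->
  canonical_nat p t' -> SIP (map Posz (t' ++ w' ++ down2 p ++ rev t')).
Proof. by move=> fw ct; apply/adj_SIP_SIP/adj_SIP_palindrome. Qed.

Lemma tshift_vindex (m : nat) u : tshift m (map (vindex m) u) = map Posz u.
Proof. by rewrite /tshift -map_comp; apply: eq_map => i /=; rewrite subrK. Qed.

Section OneSide.

Variables (F : fieldType) (m n h : nat) (A : nat -> 'M[F]_n).
Variables (w v cw cv tw tv : seq int) (X Y : seq 'M[F]_n).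
Hypotheses (m0 : (1 <= m)%N) (le_h : (h <= m - 1)%N) (even_h : ~~ odd h).
Local Notation h' := (m - h - 1)%N.
Hypotheses (sa_w : simple_admissible h w) (sa_v : simple_admissible h' (tshift m v)).
Hypotheses (sc_w : symmetric_complement h w cw)
  (sc_v : symmetric_complement h' (tshift m v) (tshift m cv)).
Hypotheses (cf_w : in_canonical_form h tw) (cf_v : in_canonical_form h' (tshift m tv)).
Hypotheses (ns_w : nonsingular_assignment m tw X) (ns_v : nonsingular_assignment m tv Y).

(** Everything that concerns one diagonal block.  The equality of [c0] and [i0]
    gives [u = z] and [v = s]; the transformations [U], [V] carry the
    off-diagonal blocks along. *)
Theorem diagonal_block :
  let L := symmetric_pencil m A w v cw cv tw tv X Y in
  let s := i0 (tw ++ w) in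
  [/\ GFPR_block A L (i0 (tw ++ w)) (c0 (w ++ cw ++ rev tw)),
      blktr L = L, c0 (w ++ cw ++ rev tw) = s &
      (~~ odd m -> A m \in unitmx) ->
      exists U V : 'M[{poly F}]_(m * n),
      [/\ U \in unitmx, V \in unitmx, U *m bcol _ m n s = bcol _ m n 0,
          brow _ m n s *m V = brow _ m n 0
        & U *m L *m V = emx m 0 m (mx_poly m A)]].
Proof.
have lt_hm : (h < m)%N by lia.
have [w' [tw' [Ew Ecw Etw pw tew fw ctw]]] := side_data_w sa_w sc_w cf_w.
have [v' [tv' [Ev_ Ecv Etv pv tev fv_ ctv]]] := side_data_v sa_v sc_v cf_v.
have rw : realizes F m n Posz (place_w m) := @realizes_w F m n.
have rv : realizes F m n (vindex m) (place_v m) := @realizes_v F m n.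
have [[szX _] [szY _]] := (ns_w, ns_v).
rewrite /assignment Etw size_map in szX; rewrite /assignment Etv size_map in szY.
have altw : all (fun i => i < m)%N tw' by apply: sub_all (canonical_nat_lt ctw) => i; lia.
have altv : all (fun i => i < m)%N tv' by apply: sub_all (canonical_nat_lt ctv) => i; lia.
have ald q : (q <= m)%N -> all (fun i => i < m)%N (down2 q).
  by move=> le; apply/allP => i; rewrite mem_down2; lia.
pose lw := zip tw' X; pose lv := zip tv' Y.
have ulw : unzip1 lw = tw' by rewrite unzip1_zip ?szX.
have ulv : unzip1 lv = tv' by rewrite unzip1_zip ?szY.
have eMw : elem_prod m tw X = emx_prod m (place_w m) lw by rewrite Etw (elem_prod_map _ rw).
have eMv : elem_prod m tv Y = emx_prod m (place_v m) lv by rewrite Etv (elem_prod_map _ rv).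
have eMw' : elem_prod m (rev tw) (rev X) = emx_prod m (place_w m) (rev lw).
  by rewrite Etw -map_rev (elem_prod_map _ rw) ?all_rev // /lw rev_zip ?szX.
have eMv' : elem_prod m (rev tv) (rev Y) = emx_prod m (place_v m) (rev lv).
  by rewrite Etv -map_rev (elem_prod_map _ rv) ?all_rev // /lv rev_zip ?szY.
have eW : elem_prodA m A w = w_odd m h A *m w_even m h A.
  by rewrite (elem_prodA_parity _ rw (place_w_layout m) lt_hm _ tew).
have eP : elem_prodA m A cw = w_odd m h A.
  by rewrite Ecw (elem_prodA_map _ rw) // ald //; lia.
have cfv q : (q <= m)%N -> parity_prod m (place_v m) q (signed_coef A (vindex m)) =
    parity_prod m (place_v m) q (fun j => A (m - j)%N).
  by move=> le; apply: eq_parity_prod => i lti; rewrite signed_coef_v //; lia.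
have eV : elem_prodA m A v = v_even m h A *m v_odd m h A.
  rewrite (elem_prodA_parity _ rv (place_v_layout m) _ _ tev); last 2 first.
  - by lia.
  - by move=> i j; rewrite /vindex; lia.
  by rewrite !cfv //; lia.
have eE : elem_prodA m A cv = v_even m h A.
  by rewrite Ecv (elem_prodA_map _ rv) ?ald ?[LHS]cfv //; lia.
have ctw_ : canonical_nat h (unzip1 lw) by rewrite ulw.
have ctv_ : canonical_nat h' (unzip1 lv) by rewrite ulv.
move=> L s.
have EL : L = nested_pencil m h A lw lv.
  rewrite /L /symmetric_pencil pencil_expand elem_prod_cat ?szY ?Etv ?size_map //.
  rewrite -Etv elem_prod_cat; last by rewrite Etw !size_rev size_map szX.
  by rewrite elem_prodA_cat eMw eMv eMw' eMv' eW eV eP eE.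
have [i0E c0E] := i0_c0_steps tw' even_h fw.
have Ei : s = foldr i0_step (1 < h)%N tw' by rewrite /s Etw Ew -map_cat.
have Ec : c0 (w ++ cw ++ rev tw) = s by rewrite Ei Etw Ew Ecw -map_rev -!map_cat.
split=> //.
- exists h, w, v, tw, (cw ++ rev tw), tv, (cv ++ rev tv).
  exists X, (trivial_assignment A cw ++ rev X), Y, (trivial_assignment A cv ++ rev Y).
  split.
    split=> //.
      by rewrite Ew; have := perm_map Posz pw; rewrite (irange_nat 0 h) subn0.
    rewrite Ev_; have := perm_map (vindex m) pv.
    congr perm_eq; rewrite /irange.
    have -> : - m%:Z <= - h%:Z - 1 by lia.
    have -> : absz (- h%:Z - 1 - - m%:Z)%R = h' by lia.
    by apply: eq_map => i; rewrite /vindex addrC.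
  have bt (p : nat) t' : canonical_nat p t' -> forall i, i \in t' -> (i.+1 < p)%N.
    by move=> ct; exact: (allP (canonical_nat_lt ct)).
  split.
    split.
    + by rewrite Etw all_map; apply/allP => i /(bt _ _ ctw) /=; lia.
    + rewrite Ecw Etw -map_rev -map_cat all_map; apply/allP => i /=.
      by rewrite mem_cat mem_rev mem_down2 => /orP[|/(bt _ _ ctw)]; lia.
    + by rewrite Etv all_map; apply/allP => i /(bt _ _ ctv) /=; rewrite /vindex; lia.
    rewrite Ecv Etv -map_rev -map_cat all_map; apply/allP => i /=; rewrite /vindex.
    by rewrite mem_cat mem_rev mem_down2 => /orP[|/(bt _ _ ctv)]; lia.
  split.
    split; first by rewrite Etw Ew Ecw -map_rev -!map_cat; apply: SIP_palindrome.
    by rewrite Etv Ev_ Ecv -map_rev -!map_cat tshift_vindex; apply: SIP_palindrome.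
  split.
    case: ns_w => sX _; case: ns_v => sY _; split=> //;
      by rewrite /assignment !size_cat !size_rev size_map ?sX ?sY.
  split=> //.
  rewrite /L /symmetric_pencil -!mulmxA; congr (_ *m (_ *m _)).
  rewrite -!map_mxM; congr (map_mx _ _).
  have eA u : elem_prod m u (trivial_assignment A u) = elem_prodA m A u by [].
  rewrite elem_prodA_cat elem_prod_cat; last by rewrite Etw !size_rev size_map szX.
  rewrite [in RHS]elem_prod_cat; last first.
    by rewrite !size_cat !size_rev size_map Etw size_map szX.
  rewrite !elem_prod_cat ?size_map // !eA eMw' eMv' eP eE -!mulmxA; congr (_ *m _).
  rewrite !mulmxA; congr (_ *m _); apply: emx_prod_vw_comm => i j.
  rewrite unzip1_down2 mem_down2 unzip1_rev mem_rev ulw => ? /(bt _ _ ctw); lia.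
- by rewrite EL; apply: blktr_nested_pencil.
move=> uA; rewrite EL Ei -ulw.
have aw := nonsingular_all Etw ns_w isT altw.
have fv0 : (vindex m 0 == 0) || (vindex m 0 == - m%:Z) by rewrite /vindex sub0r eqxx orbT.
have av := nonsingular_all Etv ns_v fv0 altv.
by apply: (nested_pencil_linearization _ _ ctw_ ctv_ fw) => //;
  apply: emx_prod_unit; rewrite ?all_rev //; (exact: place_w_layout || exact: place_v_layout).
Qed.

End OneSide.

(** This writes an off-diagonal block as a product, so that transformations of
    the two diagonal blocks act on its outer factors. *)
Lemma evec_tens (F : fieldType) m n k r (i j : nat) (B : 'M[F]_(n, r)) :
  (evec F m (m - i) *m (evec F k (k - j))^T) *t B =
  bcol F m n i *m B *m brow F k r j.
Proof.
have [le|lt_i] := leqP m i.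
  rewrite bcol_out // !mul0mx; have -> : (m - i = 0)%N by lia.
  have -> : evec F m 0 = 0 by apply/matrixP => a b; rewrite !mxE.
  by rewrite mul0mx tens0mx.
have [le|lt_j] := leqP k j.
  rewrite brow_out // !mulmx0; have -> : (k - j = 0)%N by lia.
  have -> : evec F k 0 = 0 by apply/matrixP => a b; rewrite !mxE.
  by rewrite trmx0 mulmx0 tens0mx.
apply/matrixP => x y; case: (mxtens_indexP x) => a p; case: (mxtens_indexP y) => b q.
rewrite tensmxE mxE big_ord1 !mxE.
rewrite (bigD1 q) // big1 ?addr0 => [|q' /andP[_ ne]]; last first.
  by rewrite !mxE !mxtens_indexK /= [q == q']eq_sym (negPf ne) andbF mulr0.
rewrite !mxE (bigD1 p) // big1 ?addr0 => [|p' /andP[_ ne]]; last first.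
  by rewrite !mxE !mxtens_indexK /= [p == p']eq_sym (negPf ne) andbF mul0r.
rewrite !mxE !mxtens_indexK /= !eqxx !andbT.
have -> : (a.+1 == m - i)%N = ((a + i).+1 == m) by lia.
have -> : (b.+1 == k - j)%N = ((b + j).+1 == k) by lia.
by rewrite !addr0 mulrAC.
Qed.

(** * Assembling the two diagonal blocks *)

Lemma emx_outE (R : comUnitRingType) m n a (P : 'M[R]_n) :
  emx m a m P = 1%:M + bcol R m n a *m (P - 1%:M) *m brow R m n a.
Proof.
rewrite /emx (@bcol_out R m n m (leqnn m)) (@brow_out R m n m (leqnn m)).
by rewrite !mulmx0 !mul0mx !addr0 subr0.
Qed.

(** In the second diagonal block the polynomial has to end up in the first
    position instead of the last: exchange these two blocks. *)
Lemma move_last_block (R : comUnitRingType) k r (D : 'M[R]_r) : (0 < k)%N ->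
  exists J K : 'M[R]_(k * r),
    [/\ J \in unitmx, K \in unitmx, J *m bcol R k r 0 = bcol R k r k.-1,
        brow R k r 0 *m K = brow R k r k.-1
      & J *m emx k 0 k D *m K = emx k k.-1 k D].
Proof.
move=> k0; have [->|ne] := eqVneq k.-1 0%N.
  by exists 1%:M, 1%:M; rewrite !unitmx1 !mul1mx !mulmx1.
have lt : (k.-1 < k)%N by rewrite prednK.
have ne' : 0%N != k.-1 by rewrite eq_sym.
pose J := emx k 0 k.-1 (0 : 'M[R]_r); pose K := emx k k.-1 0 (- (0 : 'M[R]_r)).
have JK : J *m K = 1%:M by apply: emx_inv.
have [uJ uK] := mulmx1_unit JK.
have J0 : J *m bcol R k r 0 = bcol R k r k.-1 by rewrite emx_bcol_fst // mulmx0 add0r.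
have K0 : brow R k r 0 *m K = brow R k r k.-1 by rewrite brow_emx_snd.
exists J, K; split=> //.
rewrite !emx_outE [J *m (_ + _)]mulmxDr mulmx1 [(J + _) *m K]mulmxDl JK.
by rewrite -!mulmxA K0 !mulmxA J0.
Qed.

Lemma rosenbrock_glue (F : fieldType) m n k r
    (PA : 'M[{poly F}]_n) (PD : 'M[{poly F}]_r)
    (LA : 'M[{poly F}]_(m * n)) (LD : 'M[{poly F}]_(k * r))
    (B : 'M[F]_(n, r)) (C : 'M[F]_(r, n)) (s t : nat)
    (UA VA : 'M[{poly F}]_(m * n)) (UD VD : 'M[{poly F}]_(k * r)) :
  (0 < m)%N -> (0 < k)%N ->
  [/\ UA \in unitmx, VA \in unitmx, UA *m bcol _ m n s = bcol _ m n 0,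
      brow _ m n s *m VA = brow _ m n 0 & UA *m LA *m VA = emx m 0 m PA] ->
  [/\ UD \in unitmx, VD \in unitmx, UD *m bcol _ k r t = bcol _ k r 0,
      brow _ k r t *m VD = brow _ k r 0 & UD *m LD *m VD = emx k 0 k PD] ->
  rosenbrock_linearization PA B C PD
    (rosen_mx (RosenForm LA (evec F m (m - s)) (evec F k (k - t)) B
                            (evec F k (k - t)) (evec F m (m - s)) C LD)).
Proof.
move=> m0 k0 [uUA uVA UAs VAs ELA] [uUD uVD UDt VDt ELD].
have [J [K [uJ uK J0 K0 EJ]]] := move_last_block PD k0.
exists UA, VA, (J *m UD), (VD *m K); split.
  by split=> //; rewrite unitmx_mul ?uJ ?uUD ?uVD.
rewrite /rosen_target /rosen_mx /= !mulmx_block !mul0mx !mulmx0 !addr0 !add0r.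
have k1 : (k - k.-1 = 1)%N by lia.
have eB := evec_tens m k 0 k.-1 B; have eC := evec_tens k m k.-1 0 C.
rewrite subn0 k1 in eB eC; rewrite !evec_tens eB eC.
rewrite !map_mxM !mxC_bcol !mxC_brow.
congr block_mx.
- have lt_m : (m.-1 < m)%N by lia.
  have m_m : (m - m.-1.+1 = 0)%N by lia.
  by rewrite ELA (blkdiag1E PA lt_m) m_m.
- by rewrite !mulmxA UAs -!mulmxA (mulmxA _ VD) VDt K0.
- by rewrite !mulmxA -(mulmxA J) UDt J0 -!mulmxA VAs.
by have := blkdiag1E PD k0; rewrite subn1 => ->; rewrite -EJ -ELD !mulmxA.
Qed.
Theorem theorem3p7 (R : realType) (m n k r h l : nat)
    (A : nat -> 'M[complex R]_n) (B : 'M[complex R]_(n, r))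
    (C : 'M[complex R]_(r, n)) (D : nat -> 'M[complex R]_r)
    (wh vh cwh cvh twh tvh wl vl cwl cvl twl tvl : seq int)
    (XA YA : seq 'M[complex R]_n) (XD YD : seq 'M[complex R]_r) :
  (1 <= m)%N -> A m != 0 -> regular_mxpoly (mx_poly m A) ->
  (1 <= k)%N -> D k != 0 ->
  (h <= m - 1)%N -> ~~ odd h ->
  (l <= k - 1)%N -> ~~ odd l ->
  simple_admissible h wh ->
  simple_admissible (m - h - 1) (tshift m vh) ->
  symmetric_complement h wh cwh ->
  symmetric_complement (m - h - 1) (tshift m vh) (tshift m cvh) ->
  in_canonical_form h twh ->
  in_canonical_form (m - h - 1) (tshift m tvh) ->
  nonsingular_assignment m twh XA ->
  nonsingular_assignment m tvh YA ->
  simple_admissible l wl ->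
  simple_admissible (k - l - 1) (tshift k vl) ->
  symmetric_complement l wl cwl ->
  symmetric_complement (k - l - 1) (tshift k vl) (tshift k cvl) ->
  in_canonical_form l twl ->
  in_canonical_form (k - l - 1) (tshift k tvl) ->
  nonsingular_assignment k twl XD ->
  nonsingular_assignment k tvl YD ->
  let L := RosenForm
    (symmetric_pencil m A wh vh cwh cvh twh tvh XA YA)
    (evec _ m (m - i0 (twh ++ wh))) (evec _ k (k - c0 (wl ++ cwl ++ rev twl)))
    B
    (evec _ k (k - i0 (twl ++ wl))) (evec _ m (m - c0 (wh ++ cwh ++ rev twh)))
    C
    (symmetric_pencil k D wl vl cwl cvl twl tvl XD YD) in
  let is_linearization :=
    rosenbrock_linearization (mx_poly m A) B C (mx_poly k D) (rosen_mx L) in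
  [/\ is_GFPR A B C D L,
      block_symmetric L,
      odd m && odd k -> is_linearization
    & ~~ odd m || ~~ odd k ->
      (~~ odd m -> A m \in unitmx) -> (~~ odd k -> D k \in unitmx) ->
      is_linearization].
Proof.
move=> m1 Am0 regA k1 Dk0 le_h ev_h le_l ev_l sa_wh sa_vh sc_wh sc_vh cf_wh cf_vh ns_wh ns_vh
  sa_wl sa_vl sc_wl sc_vl cf_wl cf_vl ns_wl ns_vl L lin.
have [gA sA cA linA] := diagonal_block A m1 le_h ev_h sa_wh sa_vh sc_wh sc_vh cf_wh cf_vh ns_wh ns_vh.
have [gD sD cD linD] := diagonal_block D k1 le_l ev_l sa_wl sa_vl sc_wl sc_vl cf_wl cf_vl ns_wl ns_vl.
have linL : (~~ odd m -> A m \in unitmx) -> (~~ odd k -> D k \in unitmx) -> lin.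
  move=> uA uD; have [UA [VA HA]] := linA uA; have [UD [VD HD]] := linD uD.
  by rewrite /lin /L cA cD; exact: rosenbrock_glue HA HD.
split.
- by exists (rfA L), (rfD L), (i0 (twh ++ wh)), (c0 (wh ++ cwh ++ rev twh)),
    (i0 (twl ++ wl)), (c0 (wl ++ cwl ++ rev twl)); split.
- by split=> //=; rewrite ?cA ?cD.
- by case/andP=> om ok; apply: linL => [/negP|/negP].
- by move=> _; exact: linL.
Qed.
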